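(* Let $N\ge5$, $d_1,\dots,d_N\ge2$, and let $\rho$ be any (normalized) mixed state on $H_1\otimes\cdots\otimes H_N$ with $\dim H_i=d_i$. Then $$C_N^2(\rho)\ \ge\ \frac{N}{2^{N-2}(d_1-1)(d_2-1)\cdots(d_N-1)}\sum_{\rho_{2\otimes\cdots\otimes2}}\ \sum_{i=1}^{N-1}\sum_{j=i+1}^{N}C_{ij}^2(\rho_{2\otimes2\otimes\cdots\otimes2}),$$ where the outer sum runs over all possible $2\otimes2\otimes\cdots\otimes2$ substates $\rho_{2\otimes\cdots\otimes2}$ of $\rho$.
   Context: Each $H_i\cong\mathbb{C}^{d_i}$ has a fixed computational basis. For a (not necessarily normalized) vector $|\varphi\rangle\in H_1\otimes\cdots\otimes H_N$ with $\sigma=|\varphi\rangle\langle\varphi|$, $C_N(|\varphi\rangle)=2^{1-N/2}\sqrt{(2^N-2)(\mathrm{tr}\,\sigma)^2-\sum_\alpha \mathrm{tr}(\sigma_\alpha^2)}$, where $\alpha$ runs over all $2^N-2$ nonempty proper subsets of $\{1,\dots,N\}$ and $\sigma_\alpha=\mathrm{tr}_{\bar\alpha}\sigma$; for mixed $\rho$, $C_N(\rho)=\min\sum_ip_iC_N(|\varphi_i\rangle)$ over all ensembles $\rho=\sum_ip_i|\varphi_i\rangle\langle\varphi_i|$. Substates: given subsets $S_i\subseteq\{1,\dots,d_i\}$ with $|S_i|=2$ and $G_i=\sum_{x\in S_i}|x\rangle\langle x|$, the $2\otimes\cdots\otimes2$ substate is the unnormalized $N$-qubit operator $(\otimes_iG_i)\rho(\otimes_iG_i)$.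 For an (unnormalized) $N$-qubit operator $\tau$, $C_{ij}(\tau)$ is the Wootters concurrence of the two-qubit reduced operator $\tau_{ij}$ (partial trace over all qubits except $i,j$): $C(\omega)=\max\{0,\lambda_1-\lambda_2-\lambda_3-\lambda_4\}$ where $\lambda_1\ge\dots\ge\lambda_4$ are the square roots of the eigenvalues of $\omega(\sigma_y\otimes\sigma_y)\omega^*(\sigma_y\otimes\sigma_y)$. *)

(* Defs.v *)
From HB Require Import structures.
From mathcomp Require Import all_boot all_order all_algebra complex reals.
Set Implicit Arguments. Unset Strict Implicit. Unset Printing Implicit Defensive.
Import Order.TTheory GRing.Theory Num.Theory.
Local Open Scope ring_scope.

(* A computational-basis vector of H_1 (x) ... (x) H_N is indexed by    *)
(* a dependent finite function x with x i : 'I_(d i).                  *)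
Definition idx (N : nat) (d : 'I_N -> nat) := {dffun forall i : 'I_N, 'I_(d i)}.

Definition sidx (N : nat) (d : 'I_N -> nat) (A : {set 'I_N}) :=
  {dffun forall i : {i : 'I_N | i \in A}, 'I_(d (sval i))}.

(* Operators on H_1 (x) ... (x) H_N are given by their matrix entries in the
   computational basis: an operator is a function idx -> idx -> C.  Vectors
   are functions idx -> C. *)

Definition glue (N : nat) (d : 'I_N -> nat) (A : {set 'I_N})
  (x : sidx d A) (z : sidx d (~: A)) : idx d :=
  @finfun _ (fun i => 'I_(d i)) (fun i =>
    match (i \in A) as b return (i \in A) = b -> 'I_(d i) with
    | true => fun h => x (exist _ i h)
    | false => fun h => z (exist _ i (ltac:(by rewrite in_setC h) : i \in ~: A))
    end erefl).

Definition ptrace (R : realType) (N : nat) (d : 'I_N -> nat) (A : {set 'I_N})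
  (sigma : idx d -> idx d -> R[i]) : sidx d A -> sidx d A -> R[i] :=
  fun x y => \sum_(z : sidx d (~: A)) sigma (glue x z) (glue y z).
Arguments ptrace {R N d} A sigma.

Definition tr_sq (R : realType) (N : nat) (d : 'I_N -> nat) (A : {set 'I_N})
  (sigma : idx d -> idx d -> R[i]) : R[i] :=
  \sum_(x : sidx d A) \sum_(y : sidx d A) ptrace A sigma x y * ptrace A sigma y x.
Arguments tr_sq {R N d} A sigma.

Definition trace (R : realType) (N : nat) (d : 'I_N -> nat)
  (sigma : idx d -> idx d -> R[i]) : R[i] := \sum_(u : idx d) sigma u u.

Definition proj (R : realType) (N : nat) (d : 'I_N -> nat)
  (phi : idx d -> R[i]) : idx d -> idx d -> R[i] :=
  fun u v => phi u * conjc (phi v).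

(* C_N(|phi>) = 2^{1-N/2} sqrt((2^N-2)(tr sigma)^2 - sum_alpha tr sigma_alpha^2),
   alpha ranging over the nonempty proper subsets of {1..N}.
   (The radicand is a real number; we take its real part.)  *)
Definition CN_pure (R : realType) (N : nat) (d : 'I_N -> nat)
  (phi : idx d -> R[i]) : R :=
  let sigma := proj phi in
  2 / Num.sqrt 2 ^+ N *
  Num.sqrt (complex.Re
    ((2 ^+ N - 2) * trace sigma ^+ 2
     - \sum_(A : {set 'I_N} | (A != set0) && (A != setT)) tr_sq A sigma)).

Definition ensemble (R : realType) (N : nat) (d : 'I_N -> nat)
  (rho : idx d -> idx d -> R[i]) (n : nat) (p : 'I_n -> R)
  (phi : 'I_n -> idx d -> R[i]) : Prop :=
  [/\ forall k, 0 <= p k,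
      \sum_k p k = 1,
      forall k, \sum_(u : idx d) phi k u * conjc (phi k u) = 1 &
      forall u v, rho u v = \sum_k ((p k)%:C)%C * proj (phi k) u v].

Definition CN (R : realType) (N : nat) (d : 'I_N -> nat)
  (rho : idx d -> idx d -> R[i]) : R :=
  inf (fun c : R => exists (n : nat) (p : 'I_n -> R) (phi : 'I_n -> idx d -> R[i]),
        ensemble rho p phi /\ c = \sum_k p k * CN_pure (phi k)).

Definition density (R : realType) (N : nat) (d : 'I_N -> nat)
  (rho : idx d -> idx d -> R[i]) : Prop :=
  [/\ forall u v, rho v u = conjc (rho u v),
      forall w : idx d -> R[i],
        0 <= \sum_(u : idx d) \sum_(v : idx d) conjc (w u) * rho u v * w v &
      trace rho = 1].

(* 2 (x) ... (x) 2 substates.  A choice of S_i = {a i, b i} with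
   a i < b i (each 2-element subset arises exactly once this way).
   N-qubit basis index q : {ffun 'I_N -> bool}; qubit value false/true of
   party i is identified with the basis vector a i / b i. *)
Definition qidx (N : nat) := {ffun 'I_N -> bool}.

Definition emb (N : nat) (d : 'I_N -> nat) (a b : idx d) (q : qidx N) : idx d :=
  @finfun _ (fun i => 'I_(d i)) (fun i => if q i then b i else a i).

(* the unnormalized N-qubit operator (G_1 (x)..(x) G_N) rho (G_1 (x)..(x) G_N) *)
Definition substate (R : realType) (N : nat) (d : 'I_N -> nat) (a b : idx d)
  (rho : idx d -> idx d -> R[i]) : qidx N -> qidx N -> R[i] :=
  fun q q' => rho (emb a b q) (emb a b q').

Definition qupd (N : nat) (z : qidx N) (i : 'I_N) (s : bool) : qidx N :=
  [ffun k => if k == i then s else z k].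

Definition red2 (R : realType) (N : nat) (tau : qidx N -> qidx N -> R[i])
  (i j : 'I_N) (s t s' t' : bool) : R[i] :=
  \sum_(z : qidx N | ~~ z i && ~~ z j)
     tau (qupd (qupd z i s) j t) (qupd (qupd z i s') j t').

(* encoding of 'I_4 as bool * bool, k = 2 s + t *)
Definition hi (k : 'I_4) : bool := (2 <= k)%N.
Definition lo (k : 'I_4) : bool := odd k.

Definition sy (R : realType) (a b : bool) : R[i] :=
  if a == b then 0 else if a then 'i%C else - 'i%C.

Definition syy (R : realType) : 'M[R[i]]_4 :=
  \matrix_(k, l) (sy R (hi k) (hi l) * sy R (lo k) (lo l)).

Definition eigenvalues (R : realType) (n : nat) (M : 'M[R[i]]_n) : seq R[i] :=
  sval (closed_field_poly_normal (char_poly M)).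

(* Wootters concurrence of a (possibly unnormalized) two-qubit operator
   omega: lambda_1 >= ... >= lambda_4 are the square roots of the
   eigenvalues of omega (sy (x) sy) omega^* (sy (x) sy).  These eigenvalues
   are nonnegative reals for positive semidefinite omega; we take the square
   root of their real part. *)
Definition wootters (R : realType) (omega : 'M[R[i]]_4) : R :=
  let M := omega *m syy R *m map_mx conjc omega *m syy R in
  let l := sort (fun x y : R => y <= x)
             [seq Num.sqrt (complex.Re r) | r <- eigenvalues M] in
  Num.max 0 (l`_0 - l`_1 - l`_2 - l`_3).

Definition Cij (R : realType) (N : nat) (tau : qidx N -> qidx N -> R[i])
  (i j : 'I_N) : R :=
  wootters (\matrix_(k, l) red2 tau i j (hi k) (lo k) (hi l) (lo l)).

(* Main.v *)
(**
For a decomposition omega = sum_j V_j V_j^* put T_ab = V_a^T (sy (x) sy) V_b.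
The lambda's of omega are the singular values of the symmetric matrix T, and
2 lambda_1 - sum lambda is at most the sum of the Frobenius norms of the
diagonal blocks of T, for every partition of the index set into blocks.  This
bounds C_ij of a mixture by any average over a measurement of the other qubits.

For an N-qubit vector psi let E_B be the squared norm of the component of
psi (x) psi antisymmetric on the qubits of B and symmetric elsewhere; E_B = 0
for |B| odd, and sum_A ((tr sigma)^2 - tr sigma_A^2) = 2^N sum_(B <> 0) E_B.
Measuring a set M of qubits in random Pauli bases, which form a 2-design, gives
  C_ij^2 <= 4 (4/3)^|M| sum of E_B over the B containing i, j and disjoint from M.
With all qubits but three measured only E_{i,j} survives and the loss (4/3)^(N-3)
is affordable as soon as N >= 6; for N = 5 this bound is averaged, with weights
3/4 and 1/4, with the one where nothing is measured.

Finally a pair (u, v) of basis vectors lies in at most prod (d_i - 1) of the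
2 (x) ... (x) 2 boxes, and Minkowski's inequality passes from pure states to
ensembles, which exist by the spectral theorem.
*)
Require Import Defs.
From HB Require Import structures.
From mathcomp Require Import all_boot all_order all_algebra complex reals.
From mathcomp Require Import spectral sesquilinear ring lra zify.
Import Order.TTheory GRing.Theory Num.Theory ComplexField.
Local Open Scope ring_scope.

(** * Finite sums and complex moduli *)

Section CauchySchwarz.
Variables (R : rcfType) (I : finType).

(** Lagrange's identity: the double sum of squares is twice the gap. *)
Lemma sum_cauchy (P : pred I) (x y : I -> R) :
  (\sum_(i | P i) x i * y i) ^+ 2
    <= (\sum_(i | P i) x i ^+ 2) * (\sum_(i | P i) y i ^+ 2).
Proof.
have H : 0 <= \sum_(i | P i) \sum_(j | P j) (x i * y j - x j * y i) ^+ 2.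
  by apply: sumr_ge0 => i _; apply: sumr_ge0 => j _; exact: sqr_ge0.
suff E : \sum_(i | P i) \sum_(j | P j) (x i * y j - x j * y i) ^+ 2 =
  2 * ((\sum_(i | P i) x i ^+ 2) * (\sum_(i | P i) y i ^+ 2)
       - (\sum_(i | P i) x i * y i) ^+ 2) by lra.
have E1 (f g : I -> R) : (\sum_(i | P i) f i) * (\sum_(i | P i) g i) =
   \sum_(i | P i) \sum_(j | P j) f i * g j.
  by rewrite mulr_suml; apply: eq_bigr => i _; rewrite mulr_sumr.
rewrite expr2 mulrBr mulr_natl mulr2n {2}(mulrC (\sum_(i | P i) x i ^+ 2)) !E1.
rewrite -big_split /= mulr_sumr -sumrB; apply: eq_bigr => i _.
rewrite -big_split /= mulr_sumr -sumrB; apply: eq_bigr => j _; ring.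
Qed.

Lemma sum_cauchy_sqrt (P : pred I) (x y : I -> R) :
  \sum_(i | P i) x i * y i
    <= Num.sqrt (\sum_(i | P i) x i ^+ 2) * Num.sqrt (\sum_(i | P i) y i ^+ 2).
Proof.
rewrite -sqrtrM; last by apply: sumr_ge0 => i _; exact: sqr_ge0.
apply: le_trans (ler_norm _) _; rewrite -sqrtr_sqr.
exact/ler_wsqrtr/sum_cauchy.
Qed.

End CauchySchwarz.

Section NormC.
Variable R : rcfType.
Implicit Types z w : R[i].
Local Notation normc := (@Normc.normc R).

Lemma conjcE z : z^* = conjc z. Proof. by []. Qed.

Lemma normc_ge0 z : 0 <= normc z.
Proof. by case: z => a b; exact: sqrtr_ge0. Qed.

Lemma normcMJ z : (normc z ^+ 2)%:C%C = z * conjc z.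
Proof.
by rewrite -sqr_normc rmorphXn /= normc_def; case: z.
Qed.

Lemma normc_conj z : normc (conjc z) = normc z.
Proof. by case: z => a b /=; rewrite sqrrN. Qed.

Lemma normc_realC (r : R) : 0 <= r -> normc r%:C%C = r.
Proof. by move=> r0; rewrite /= expr0n addr0 sqrtr_sqr ger0_norm. Qed.

Lemma normc_sum (I : finType) (P : pred I) (F : I -> R[i]) :
  normc (\sum_(i | P i) F i) <= \sum_(i | P i) normc (F i).
Proof.
elim/big_rec2 : _ => [|i x y _ H]; first by rewrite Normc.normc0.
by apply: le_trans (le_normcD _ _) _; rewrite lerD2l.
Qed.

End NormC.

(** * Wootters' concurrence *)

Section SymmetricBlocks.
Local Open Scope sesquilinear_scope.
Variables (R : rcfType) (n : nat) (K : finType) (lab : 'I_n -> K).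
Variables (T P : 'M[R[i]]_n) (D : 'I_n -> R).
Local Notation normc := (@Normc.normc R).
Hypothesis symT : T^T = T.
Hypothesis unitP : P *m P^t* = 1%:M.
Hypothesis D0 : forall a, 0 <= D a.
Hypothesis TT : T^t* *m T = P^t* *m diag_mx (\row_a (D a)%:C%C) *m P.

(** The conjugated rows of [P] are the right singular vectors of [T]; the columns of [G] are their
    images. *)
Let G := T *m P^t*.

Lemma unitP' : P^t* *m P = 1%:M.
Proof. exact: mulmx1C. Qed.

Lemma T_GP : T = G *m P.
Proof. by rewrite /G -mulmxA unitP' mulmx1. Qed.

Lemma col_G_norm a : \sum_x normc (G x a) ^+ 2 = D a.
Proof.
apply: (@complexI R); rewrite rmorph_sum /=.
have : (G^t* *m G) a a = (diag_mx (\row_a (D a)%:C%C)) a a.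
  rewrite /G trmx_mul map_mxM /= trmxCK mulmxA -(mulmxA P) TT !mulmxA unitP.
  by rewrite mul1mx -mulmxA unitP mulmx1.
rewrite !mxE eqxx mulr1n => <-; apply: eq_bigr => x _.
by rewrite normcMJ mulrC !mxE.
Qed.

Lemma row_P_norm a : \sum_x normc (P a x) ^+ 2 = 1.
Proof.
apply: (@complexI R); rewrite rmorph_sum /=.
transitivity ((P *m P^t*) a a); last by rewrite unitP !mxE eqxx.
by rewrite mxE; apply: eq_bigr => x _; rewrite normcMJ !mxE.
Qed.

(** Takagi form of a simple singular value. Since [T] is symmetric, multiplying the conjugate of an
    eigenvector row by [T] gives an eigenvector for the same eigenvalue. Simplicity makes it
    proportional to the original row, and norms fix the modulus of the factor. *)
Lemma top_Takagi a0 : (forall a, a != a0 -> D a != D a0) ->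
  exists2 c : R[i], normc c = Num.sqrt (D a0) & forall x, G x a0 = c * P a0 x.
Proof.
move=> simp.
pose r := (col a0 G)^T; pose H := T^t* *m T.
pose p := row a0 P.
have rE : r = map_mx Num.conj p *m T.
  apply/rowP => x; rewrite !mxE; apply: eq_bigr => z _.
  by rewrite -{1}symT !mxE mulrC.
have pH : p *m H = (D a0)%:C%C *: p.
  rewrite /p /H TT -row_mul !mulmxA unitP mul1mx.
  apply/rowP => x; rewrite !mxE (bigD1 a0) //= big1 ?addr0 => [|y /negPf ya].
    by rewrite !mxE eqxx mulr1n.
  by rewrite !mxE eq_sym ya mulr0n mul0r.
have Tt : T^t* = map_mx Num.conj T by rewrite symT.
have rH : r *m H = (D a0)%:C%C *: r.
  rewrite {1}rE /H Tt mulmxA -(mulmxA (map_mx Num.conj p)).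
  have -> : map_mx Num.conj p *m (T *m map_mx Num.conj T) = map_mx Num.conj (p *m H).
    rewrite /H Tt !map_mxM /=; congr (_ *m (_ *m _)).
    by apply/matrixP => x y; rewrite !mxE conjCK.
  rewrite pH map_mxZ /= -scalemxAl -rE; congr (_ *: _).
  by rewrite conjcE conjc_real.
(* Coordinates of [r] in the eigenbasis; the eigenvalue equation kills all but the one at [a0]. *)
pose y := r *m P^t*.
have yD a : y 0 a * (D a)%:C%C = (D a0)%:C%C * y 0 a.
  have : (y *m diag_mx (\row_a (D a)%:C%C)) 0 a = ((D a0)%:C%C *: y) 0 a.
    rewrite /y scalemxAl -rH /H TT -!mulmxA unitP mulmx1.
    by rewrite !mulmxA.
  rewrite !mxE (bigD1 a) //= big1 ?addr0 => [|b /negPf ba].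
    by rewrite !mxE eqxx mulr1n.
  by rewrite !mxE ba mulr0n mulr0.
have y0 a : a != a0 -> y 0 a = 0.
  move=> /simp aD; apply/eqP; move/eqP: (yD a).
  rewrite -subr_eq0 mulrC -mulrBl mulf_eq0 => /orP[|//].
  by rewrite -rmorphB /= => /eqP [] /eqP; rewrite subr_eq0 (negPf aD).
have rP x : G x a0 = y 0 a0 * P a0 x.
  have -> : G x a0 = (y *m P) 0 x by rewrite /y -mulmxA unitP' mulmx1 !mxE.
  by rewrite mxE (bigD1 a0) //= big1 ?addr0 // => a /y0 ->; rewrite mul0r.
exists (y 0 a0) => //.
rewrite -(col_G_norm a0).
under eq_bigr => x _ do rewrite rP Normc.normcM exprMn.
by rewrite -mulr_sumr row_P_norm mulr1 sqrtr_sqr ger0_norm // normc_ge0.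
Qed.

Let lam a := Num.sqrt (D a).

(** AM-GM for [u / l] and [l * v]. At [l = 0] the quotient is 0 by convention, and the last
    hypothesis makes the left side vanish as well. *)
Lemma amgm (u v l : R) : 0 <= u -> 0 <= v -> 0 <= l -> (l = 0 -> u = 0) ->
  Num.sqrt u * Num.sqrt v <= (u / l + l * v) / 2.
Proof.
move=> u0 v0; rewrite le_eqVlt => /orP[/eqP <- /(_ erefl) ->|l0 _].
  by rewrite sqrtr0 !mul0r addr0 mul0r.
have sl : Num.sqrt l ^+ 2 = l by rewrite sqr_sqrtr // ltW.
have sl0 : 0 < Num.sqrt l by rewrite sqrtr_gt0.
have -> : u / l = (Num.sqrt u / Num.sqrt l) ^+ 2.
  by rewrite exprMn exprVn sl sqr_sqrtr.
have -> : l * v = (Num.sqrt l * Num.sqrt v) ^+ 2.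
  by rewrite exprMn sl sqr_sqrtr.
have -> : Num.sqrt u * Num.sqrt v =
  (Num.sqrt u / Num.sqrt l) * (Num.sqrt l * Num.sqrt v).
  by field; rewrite gt_eqF.
move: (sqr_ge0 (Num.sqrt u / Num.sqrt l - Num.sqrt l * Num.sqrt v)).
by rewrite sqrrB; lra.
Qed.

(* Each block is tested against the corresponding block of the top singular
   vector; its contribution to the other singular directions is absorbed by
   AM-GM. *)
Lemma symmetric_blocks_bound a0 :
  2 * lam a0 - \sum_a lam a <= \sum_k
    Num.sqrt (\sum_(x | lab x == k) \sum_(y | lab y == k) normc (T x y) ^+ 2).
Proof.
have rhs0 : 0 <= \sum_k
    Num.sqrt (\sum_(x | lab x == k) \sum_(y | lab y == k) normc (T x y) ^+ 2).
  by apply: sumr_ge0 => k _; exact: sqrtr_ge0.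
have lam0 a : 0 <= lam a by exact: sqrtr_ge0.
rewrite (bigD1 a0) //=.
set S := \sum_(i | i != a0) lam i.
(* If [lam a0] does not exceed the sum of the others, the left side is not positive. Otherwise
   [D a0] is a simple eigenvalue. *)
have [le|lt] := lerP (lam a0) S; first by apply: le_trans rhs0; lra.
have simp a : a != a0 -> D a != D a0.
  move=> aa; apply/eqP => Da; move: lt.
  rewrite /S (bigD1 a) //= {1}/lam Da -/(lam a0).
  have : 0 <= \sum_(i | (i != a0) && (i != a)) lam i by apply: sumr_ge0.
  lra.
have [c cn cG] := top_Takagi _ simp.
pose N k := \sum_(x | lab x == k) normc (P a0 x) ^+ 2.
pose u k a := \sum_(x | lab x == k) normc (G x a) ^+ 2.
pose v k a := \sum_(x | lab x == k) normc (P a x) ^+ 2.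
have sq_sum0 (f : 'I_n -> R) k : 0 <= \sum_(x | lab x == k) f x ^+ 2.
  by apply: sumr_ge0 => x _; exact: sqr_ge0.
have tot (f : 'I_n -> R) : \sum_k \sum_(x | lab x == k) f x = \sum_x f x.
  by rewrite (partition_big lab predT).
(* Loss in block [k] from the other singular directions. Over all blocks [u] sums to [D a] and [v]
   to 1, so the losses add up to [S]. *)
pose w k := \sum_(a | a != a0) (u k a / lam a + lam a * v k a) / 2.
suff key k : lam a0 * N k - w k <=
   Num.sqrt (\sum_(x | lab x == k) \sum_(y | lab y == k) normc (T x y) ^+ 2).
  apply: (@le_trans _ _ (\sum_k (lam a0 * N k - w k))); last exact: ler_sum.
  rewrite sumrB -mulr_sumr tot row_P_norm exchange_big /=.
  have -> : \sum_(j | j != a0) \sum_i (u i j / lam j + lam j * v i j) / 2 = S.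
    apply: eq_bigr => a _; rewrite -mulr_suml big_split /= -mulr_suml -mulr_sumr.
    rewrite !tot row_P_norm col_G_norm mulr1.
    have -> : D a / lam a = lam a.
      have [l0|l0] := eqVneq (lam a) 0; first by rewrite l0 invr0 mulr0.
      by rewrite -{1}(sqr_sqrtr (D0 a)) -/(lam a); field.
    by lra.
  lra.
set F := Num.sqrt _.
have N0 : 0 <= N k by exact: sq_sum0.
have w0 : 0 <= w k.
  apply: sumr_ge0 => a _; rewrite divr_ge0 // addr_ge0 ?divr_ge0 ?mulr_ge0 //;
  exact: sq_sum0.
have [Nk|Nk] := eqVneq (N k) 0.
  by rewrite Nk mulr0 sub0r (le_trans _ (sqrtr_ge0 _)) // oppr_le0.
have Np : 0 < N k by rewrite lt_neqAle eq_sym Nk.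
rewrite -(ler_pM2r Np) mulrBl.
(* The block of [T] paired with the top vector on both sides: at most [F * N k] by Cauchy-Schwarz,
   while [T = G *m P] isolates a top term of modulus [lam a0 * N k ^+ 2]. *)
pose t := \sum_(x | lab x == k) \sum_(y | lab y == k)
            T x y * (conjc (P a0 x) * conjc (P a0 y)).
have tF : normc t <= F * N k.
  have -> : N k = Num.sqrt (\sum_(x | lab x == k) \sum_(y | lab y == k)
      normc (conjc (P a0 x) * conjc (P a0 y)) ^+ 2).
    rewrite -[LHS]ger0_norm // -sqrtr_sqr expr2 {1 2}/N mulr_suml.
    congr Num.sqrt; apply: eq_bigr => x _; rewrite mulr_sumr.
    by apply: eq_bigr => y _; rewrite Normc.normcM !normc_conj exprMn.
  rewrite /t /F pair_big /= pair_big /= pair_big /=.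
  apply: le_trans (normc_sum _ _ _ _) _.
  rewrite (eq_bigr (fun p => normc (T p.1 p.2) * normc (conjc (P a0 p.1) * conjc (P a0 p.2)))); last by move=> p _; rewrite Normc.normcM.
  exact: sum_cauchy_sqrt.
pose al a := \sum_(x | lab x == k) G x a * conjc (P a0 x).
pose be a := \sum_(y | lab y == k) P a y * conjc (P a0 y).
have tE : t = \sum_a al a * be a.
  rewrite /t /al /be; under [RHS]eq_bigr do rewrite mulr_suml.
  rewrite [RHS]exchange_big; apply: eq_bigr => x _ /=.
  under [RHS]eq_bigr do rewrite mulr_sumr.
  rewrite [RHS]exchange_big; apply: eq_bigr => y _ /=.
  rewrite {1}T_GP mxE mulr_suml; apply: eq_bigr => a _; ring.
have NC : (N k)%:C%C = be a0.
  by rewrite rmorph_sum; apply: eq_bigr => y _; rewrite /= normcMJ.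
have al0 : al a0 = c * (N k)%:C%C.
  by rewrite NC mulr_sumr; apply: eq_bigr => x _; rewrite cG mulrA.
have rest : normc (\sum_(a | a != a0) al a * be a) <= w k * N k.
  apply: le_trans (normc_sum _ _ _ _) _; rewrite mulr_suml.
  apply: ler_sum => a _; rewrite Normc.normcM.
  have lu : lam a = 0 -> u k a = 0.
    move=> l0; have Da : D a = 0 by rewrite -(sqr_sqrtr (D0 a)) -/(lam a) l0 expr0n.
    have : u k a <= D a.
      rewrite -(col_G_norm a) /u [leRHS](bigID (fun x => lab x == k)) /= lerDl.
      by apply: sumr_ge0 => x _; exact: sqr_ge0.
    by rewrite Da => H; apply/eqP; rewrite eq_le H sq_sum0.
  have nN f g : normc (\sum_(x | lab x == k) f x * conjc (g x)) <=
    Num.sqrt (\sum_(x | lab x == k) normc (f x) ^+ 2) *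
    Num.sqrt (\sum_(x | lab x == k) normc (g x) ^+ 2).
    apply: le_trans (normc_sum _ _ _ _) _.
    under eq_bigr do rewrite Normc.normcM normc_conj.
    exact: sum_cauchy_sqrt.
  apply: le_trans (ler_pM (normc_ge0 _ _) (normc_ge0 _ _) (nN _ _) (nN _ _)) _.
  rewrite mulrACA -/(N k) -expr2 sqr_sqrtr // ler_wpM2r //.
  by apply: amgm => //; exact: sq_sum0.
have : normc (al a0 * be a0) <= normc t + normc (\sum_(a | a != a0) al a * be a).
  have -> : al a0 * be a0 = t - \sum_(a | a != a0) al a * be a.
    by rewrite tE (bigD1 a0) //= addrK.
  by apply: le_trans (le_normcD _ _) _; rewrite normcN.
rewrite al0 -NC !Normc.normcM normc_realC // cn -/(lam a0).
lra.
Qed.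

End SymmetricBlocks.

(** Sylvester's identity: [M] becomes block triangular in two ways, by a right factor of determinant
    1 and by a left factor of determinant ['X^n]. *)
Lemma char_poly_mulC (F : comNzRingType) (m n : nat) (A : 'M[F]_(m, n))
    (B : 'M[F]_(n, m)) :
  'X^n * char_poly (A *m B) = 'X^m * char_poly (B *m A).
Proof.
pose A' := map_mx (@polyC F) A; pose B' := map_mx (@polyC F) B.
pose M := block_mx ('X%:M : 'M_m) A' B' (1%:M : 'M_n).
have detM : \det M = char_poly (A *m B).
  have <- : \det (M *m block_mx 1%:M 0 (- B') 1%:M) = \det M.
    by rewrite det_mulmx det_lblock !det1 !mulr1.
  rewrite mulmx_block !mulmx1 !mulmx0 !mul1mx ?add0r subrr det_ublock det1.
  by rewrite mulr1 /char_poly /char_poly_mx map_mxM /= mulmxN.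
have : \det (block_mx 1%:M 0 (- B') ('X%:M : 'M_n) *m M) = 'X^n * \det M.
  by rewrite det_mulmx det_lblock det1 mul1r det_scalar.
rewrite mulmx_block !mul1mx !mul0mx !addr0 mulmx1 mulNmx scalar_mxC addNr.
rewrite det_ublock det_scalar detM => <-.
by rewrite /char_poly /char_poly_mx map_mxM /= mulNmx addrC.
Qed.

Section Gram.
Local Open Scope sesquilinear_scope.

Lemma gram_adj (C : numClosedFieldType) (m n p : nat) (A : 'M[C]_(m, n))
    (B : 'M[C]_(m, p)) : (A^t* *m B)^t* = B^t* *m A.
Proof. by rewrite trmx_mul map_mxM /= trmxCK. Qed.

Lemma gram_mul (C : numClosedFieldType) (m n p : nat) (A : 'M[C]_(m, n))
    (B : 'M[C]_(n, p)) : (A *m B)^t* *m (A *m B) = B^t* *m (A^t* *m A) *m B.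
Proof. by rewrite trmx_mul map_mxM /= !mulmxA. Qed.

Lemma congr_adj (C : numClosedFieldType) (m n : nat) (W : 'M[C]_(m, n))
    (S : 'M[C]_m) : (W^T *m S *m W)^t* = W^t* *m S^t* *m map_mx Num.conj W.
Proof. by rewrite !trmx_mul !map_mxM /= trmxK mulmxA. Qed.

End Gram.

(** * Concurrence of a decomposed two-qubit operator *)

Section Wootters.
Local Open Scope sesquilinear_scope.
Variable R : realType.
Local Notation normc := (@Normc.normc R).

Lemma conjc_syy : map_mx conjc (syy R) = syy R.
Proof.
apply/matrixP => k l; rewrite !mxE rmorphM /= /sy.
by do 2![case: eqP => _; rewrite ?conjc0 ?mul0r ?mulr0 //];
  case: (hi k); case: (lo k); simpc.
Qed.

Lemma syy_sym : (syy R)^T = syy R.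
Proof.
apply/matrixP => k l; rewrite !mxE /sy.
by case: (hi k); case: (hi l); case: (lo k); case: (lo l) => /=; simpc.
Qed.

(** With the [V j] as columns of [W], the Wootters matrix is [W *m X] and [T^t* *m T] is [X *m W]
    for the same [X], so their spectra agree up to zeros. First minus the other three is twice the
    first minus the sum, which the block bound controls. *)
Lemma wootters_bound (J K : finType) (lab : J -> K) (V : J -> 'I_4 -> R[i])
    (omega : 'M[R[i]]_4) :
  (forall k l, omega k l = \sum_j V j k * conjc (V j l)) ->
  wootters omega <= \sum_c Num.sqrt (\sum_(a | lab a == c) \sum_(b | lab b == c)
    normc (\sum_k \sum_l V a k * syy R k l * V b l) ^+ 2).
Proof.
move=> omegaE; set n := #|J|.
pose W : 'M[R[i]]_(4, n) := \matrix_(k, a) V (enum_val a) k.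
have oW : omega = W *m W^t*.
  apply/matrixP => k l; rewrite omegaE mxE (reindex (@enum_val J J)) /=.
    by apply: eq_bigr => a _; rewrite !mxE.
  exact: onW_bij (enum_val_bij _).
pose T := W^T *m syy R *m W.
have symT : T^T = T by rewrite /T !trmx_mul trmxK syy_sym mulmxA.
have TE a b : T a b =
    \sum_k \sum_l V (enum_val a) k * syy R k l * V (enum_val b) l.
  rewrite mxE exchange_big; apply: eq_bigr => l _; rewrite mxE mulr_suml.
  by apply: eq_bigr => k _; rewrite !mxE.
pose H := T^t* *m T.
have Hn : H \is normalmx.
  by apply/normalmxP; rewrite /H gram_adj.
pose P := spectralmx H.
have uP : P *m P^t* = 1%:M by apply/unitarymxP; exact: spectral_unitarymx.
have HP : H = P^t* *m diag_mx (spectral_diag H) *m P.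
  have := orthomx_spectralP Hn.
  by rewrite invmx_unitary ?spectral_unitarymx.
pose D a := \sum_x normc ((T *m P^t*) x a) ^+ 2.
have DE : spectral_diag H = \row_a (D a)%:C%C.
  apply/rowP => a; rewrite !mxE rmorph_sum /=.
  transitivity ((diag_mx (spectral_diag H)) a a); first by rewrite mxE eqxx mulr1n.
  have <- : P *m H *m P^t* = diag_mx (spectral_diag H).
    by rewrite {1}HP !mulmxA uP mul1mx -mulmxA uP mulmx1.
  have -> : P *m H *m P^t* = (T *m P^t*)^t* *m (T *m P^t*).
    by rewrite gram_mul trmxCK.
  by rewrite mxE; apply: eq_bigr => x _; rewrite normcMJ mulrC !mxE.
have D0 a : 0 <= D a by apply: sumr_ge0 => x _; exact: sqr_ge0.
rewrite DE in HP.
have charH : char_poly H = \prod_a ('X - (D a)%:C%C%:P).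
  have : 'X^n * char_poly H = 'X^n * char_poly (diag_mx (\row_a (D a)%:C%C)).
    rewrite HP -mulmxA char_poly_mulC -mulmxA uP mulmx1 //.
  move/(mulfI _) => -> //; last by rewrite expf_neq0 // polyX_eq0.
  rewrite char_poly_trig ?diag_mx_is_trig //.
  by apply: eq_bigr => a _; rewrite !mxE eqxx mulr1n.
rewrite /wootters; set M := omega *m _ *m _ *m _.
have charM : 'X^n * char_poly M = 'X^4 * char_poly H.
  have Sa : (syy R)^t* = syy R by rewrite syy_sym; exact: conjc_syy.
  have WE : map_mx conjc (W *m W^t*) = map_mx conjc W *m W^T.
    by rewrite map_mxM; congr (_ *m _); apply/matrixP => k l; rewrite !mxE; exact: conjcK.
  rewrite /M {1}oW oW WE /H /T (congr_adj _ _ _ W (syy R)) Sa.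
  by rewrite -!mulmxA char_poly_mulC -!mulmxA.
have eM : char_poly M = \prod_(r <- eigenvalues M) ('X - r%:P).
  rewrite /eigenvalues; case: closed_field_poly_normal => s /= {1}->.
  by rewrite (monicP (char_poly_monic _)) scale1r.
set s := eigenvalues M in eM *.
pose f (r : R[i]) := Num.sqrt (complex.Re r).
have ss : size s = 4%N.
  by apply/succn_inj; rewrite -(size_prod_XsubC _ id) -eM size_char_poly.
have prod0 m : \prod_(r <- nseq m (0 : R[i])) ('X - r%:P) = 'X^m :> {poly R[i]}.
  by rewrite big_nseq iter_mulr_1 polyC0 subr0.
(* The 4 eigenvalues of [M] and the [n] of [H] agree once both lists are padded with zeros to length
   [n + 4]. *)
have perm1 : perm_eq (s ++ nseq n 0) ([seq (D a)%:C%C | a : 'I_n] ++ nseq 4 0).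
  apply: prod_XsubC_eq; rewrite !big_cat /= !prod0 -eM mulrC charM mulrC.
  by rewrite charH big_image -(prod0 4).
set l := sort _ _.
have perm2 : perm_eq (l ++ nseq n 0) ([seq Num.sqrt (D a) | a : 'I_n] ++ nseq 4 0).
  have /perm_trans -> // : perm_eq (l ++ nseq n 0) (map f (s ++ nseq n 0)).
    by rewrite map_cat map_nseq /f /= sqrtr0 perm_cat2r perm_sort.
  have := perm_map f perm1.
  rewrite [in X in perm_eq _ X]map_cat map_nseq /f /= sqrtr0 -map_comp.
  by rewrite (eq_map (g := fun a => Num.sqrt (D a))).
have sl : size l = 4%N by rewrite size_sort size_map.
have suml : \sum_(x <- l) x = \sum_a Num.sqrt (D a).
  have := perm_big _ perm2 (op := +%R) (x := 0) (P := predT) (F := id).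
  rewrite !big_cat /= !big_nseq !iter_addr_0 !mul0rn !addr0 big_image /=.
  by rewrite !big_cons big_nil !addr0.
have bnd := @symmetric_blocks_bound R n K (fun a => lab (enum_val a)) T P D symT uP D0 HP.
set B := \sum_c _.
have BE : B = \sum_c Num.sqrt (\sum_(x | lab (enum_val x) == c)
     \sum_(y | lab (enum_val y) == c) normc (T x y) ^+ 2).
  apply: eq_bigr => c _; congr Num.sqrt.
  rewrite (reindex (@enum_val J J)) /=; last exact: onW_bij (enum_val_bij _).
  apply: eq_bigr => x _.
  rewrite (reindex (@enum_val J J)) /=; last exact: onW_bij (enum_val_bij _).
  by apply: eq_bigr => y _; rewrite TE.
rewrite -BE in bnd.
have B0 : 0 <= B by apply: sumr_ge0 => c _; exact: sqrtr_ge0.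
rewrite ge_max B0 /=.
have lge x : x \in l -> 0 <= x by rewrite mem_sort => /mapP [r _ ->]; exact: sqrtr_ge0.
have l00 : l`_0 \in l ++ nseq n 0 by rewrite mem_cat mem_nth ?sl.
move: suml sl lge l00; rewrite (perm_mem perm2) mem_cat.
case: l {perm2} => [|l0 [|l1 [|l2 [|l3 []]]]] //= suml _ lge.
rewrite !big_cons big_nil in suml.
have [p1 p2 p3] : [/\ 0 <= l1, 0 <= l2 & 0 <= l3].
  by split; apply: lge; rewrite !inE eqxx ?orbT.
(* Either the first square root is some [Num.sqrt (D a)], or it is a padding zero and the difference
   is not positive. *)
case/orP => [/imageP [a _ l0E]|].
  by have := bnd a; rewrite -suml l0E; lra.
rewrite -[_ \in _]/(l0 \in nseq 4 0) mem_nseq => /eqP l0E; lra.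
Qed.

End Wootters.

(** * Two copies of a pure qubit state *)

Section Doubled.
Variables (R : realType) (N : nat).
Local Notation normc := (@Normc.normc R).
Local Notation C := R[i].
Local Notation bb := (bool * bool)%type.

Definition didx := {ffun 'I_N -> bb}.
Definition left_idx (e : didx) : qidx N := [ffun l => (e l).1].
Definition right_idx (e : didx) : qidx N := [ffun l => (e l).2].
Definition join_idx (q q' : qidx N) : didx := [ffun l => (q l, q' l)].

Lemma sum_didx (V : nmodType) (F : qidx N -> qidx N -> V) :
  \sum_q \sum_q' F q q' = \sum_(e : didx) F (left_idx e) (right_idx e).
Proof.
rewrite pair_big /= (reindex (fun e => (left_idx e, right_idx e))) //=.
exists (fun p => join_idx p.1 p.2) => [e _|[q q'] _] /=.
  by apply/ffunP => l; rewrite !ffunE; case: (e l).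
by congr pair; apply/ffunP => l; rewrite !ffunE.
Qed.

Variable psi : qidx N -> C.

Definition doubled (e : didx) : C := psi (left_idx e) * psi (right_idx e).

(* The product kernel [K] as a Hermitian form evaluated at psi (x) psi, the two
   copies of qubit l being paired in the l-th factor. *)
Definition dform (K : 'I_N -> bb -> bb -> C) : C :=
  \sum_(e : didx) \sum_(e' : didx) (\prod_l K l (e l) (e' l)) * (conjc (doubled e) * doubled e').

(** [symk] and [altk] are the projections of two copies of one qubit onto the symmetric subspace and
    onto the singlet. *)
Definition symk (e e' : bb) : C := ((e == e')%:R + (e == (e'.2, e'.1))%:R) / 2.
Definition altk (e e' : bb) : C := ((e == e')%:R - (e == (e'.2, e'.1))%:R) / 2.

Lemma eq_dform K K' : (forall l e e', K l e e' = K' l e e') -> dform K = dform K'.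
Proof.
move=> H; apply: eq_bigr => e _; apply: eq_bigr => e' _; congr (_ * _).
by apply: eq_bigr.
Qed.

(** A product of Gram kernels is a Gram kernel: multiplying out over the qubits gives one square for
    each choice function [c]. *)
Lemma dform_gram (I : finType) (D : 'I_N -> pred I) (F : 'I_N -> I -> bb -> C) K :
  (forall l e e', K l e e' = \sum_(c | D l c) conjc (F l c e) * F l c e') ->
  dform K = (\sum_(c : {ffun 'I_N -> I} | [forall l, D l (c l)])
    normc (\sum_(e : didx) (\prod_l F l (c l) (e l)) * doubled e) ^+ 2)%:C%C.
Proof.
move=> KE; rewrite rmorph_sum /=.
under [RHS]eq_bigr => c _.
  rewrite normcMJ mulrC rmorph_sum mulr_suml /=.
  under eq_bigr => e _ do rewrite mulr_sumr.
  over.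
rewrite [RHS]exchange_big; apply: eq_bigr => e _ /=.
rewrite [RHS]exchange_big; apply: eq_bigr => e' _ /=.
under eq_bigr => l _ do rewrite KE.
rewrite bigA_distr_big_dep /= mulr_suml.
apply: eq_big => [c|c _].
  by apply/familyP/forallP.
rewrite big_split [in RHS]rmorphM rmorph_prod /=. ring.
Qed.

Lemma dform_expand (x y : 'I_N -> C) (k1 k2 : bb -> bb -> C) K :
  (forall l e e', K l e e' = y l * k2 e e' + x l * k1 e e') ->
  dform K = \sum_(B : {set 'I_N}) (\prod_l if l \in B then y l else x l) *
    dform (fun l => if l \in B then k2 else k1).
Proof.
move=> KE; rewrite /dform; under [RHS]eq_bigr do rewrite mulr_sumr.
rewrite [RHS]exchange_big; apply: eq_bigr => e _ /=.
under [RHS]eq_bigr do rewrite mulr_sumr.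
rewrite [RHS]exchange_big; apply: eq_bigr => e' _ /=.
under eq_bigr => l _ do rewrite KE.
rewrite bigA_distr mulr_suml; apply: eq_bigr => B _.
rewrite [RHS]mulrA; congr (_ * _); rewrite -big_split /=.
by apply: eq_bigr => l _; case: ifP.
Qed.

(* Squared norm of the component of psi (x) psi that is antisymmetric on the
   qubits of [B] and symmetric on the others. *)
Definition alt_weight (B : {set 'I_N}) : R :=
  complex.Re (dform (fun l => if l \in B then altk else symk)).

Lemma conjc_symk e e' : conjc (symk e e') = symk e e'.
Proof. by rewrite /symk rmorphM rmorphD fmorphV !rmorph_nat. Qed.

Lemma conjc_altk e e' : conjc (altk e e') = altk e e'.
Proof. by rewrite /altk rmorphM rmorphB fmorphV !rmorph_nat. Qed.

Lemma sum_bb (V : nmodType) (F : bb -> V) :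
  \sum_c F c = F (true, true) + F (true, false) + (F (false, true) + F (false, false)).
Proof.
transitivity (\sum_(p : bb) F (p.1, p.2)); first by apply: eq_bigr => -[].
by rewrite -(pair_bigA _ (fun a b => F (a, b))) /= !big_bool.
Qed.

Lemma symk_proj e e' : symk e e' = \sum_c conjc (symk c e) * symk c e'.
Proof.
rewrite sum_bb !conjc_symk.
by case: e => [[] []]; case: e' => [[] []]; rewrite /symk !xpair_eqE /=; field.
Qed.

Lemma altk_proj e e' : altk e e' = \sum_c conjc (altk c e) * altk c e'.
Proof.
rewrite sum_bb !conjc_altk.
by case: e => [[] []]; case: e' => [[] []]; rewrite /altk !xpair_eqE /=; field.
Qed.

Lemma alt_weightE (B : {set 'I_N}) :
  dform (fun l => if l \in B then altk else symk) = (alt_weight B)%:C%C.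
Proof.
rewrite /alt_weight (dform_gram bb (fun _ => predT)
  (fun l => if l \in B then altk else symk)) //.
by move=> l e e'; case: ifP => _; [exact: altk_proj | exact: symk_proj].
Qed.

Lemma alt_weight_ge0 B : 0 <= alt_weight B.
Proof.
rewrite /alt_weight (dform_gram bb (fun _ => predT)
  (fun l => if l \in B then altk else symk)); last first.
  by move=> l e e'; case: ifP => _; [exact: altk_proj | exact: symk_proj].
by apply: sumr_ge0 => c _; exact: sqr_ge0.
Qed.

(* psi (x) psi is invariant under the global exchange of the two copies. *)
Lemma alt_weight_odd (B : {set 'I_N}) : odd #|B| -> alt_weight B = 0.
Proof.
move=> oB; suff : alt_weight B = - alt_weight B by lra.
pose sw (e : didx) : didx := join_idx (right_idx e) (left_idx e).
have swK : involutive sw.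
  by move=> e; apply/ffunP => l; rewrite !ffunE /=; case: (e l).
apply: (@complexI R); rewrite rmorphN /= -!alt_weightE {1}/dform.
rewrite (reindex_inj (inv_inj swK)) /= -sumrN; apply: eq_bigr => e _.
rewrite -sumrN; apply: eq_bigr => e' _.
have -> : doubled (sw e) = doubled e.
  rewrite /doubled mulrC; congr (psi _ * psi _); apply/ffunP => l;
  by rewrite !ffunE.
rewrite -mulNr; congr (_ * _).
have E l : (if l \in B then altk else symk) (sw e l) (e' l) =
  (if l \in B then -1 else 1) * (if l \in B then altk else symk) (e l) (e' l).
  rewrite !ffunE; case: (e l) => a b; case: (e' l) => c d.
  by case: ifP => _; rewrite /altk /symk /= !xpair_eqE [(b == c) && _]andbC [(b == d) && _]andbC; field.
under eq_bigr => l _ do rewrite E.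
rewrite big_split /= -big_mkcond /= prodr_const.
by rewrite -signr_odd oB expr1 mulN1r.
Qed.

Definition swap_on (B : {set 'I_N}) (e : didx) : didx :=
  [ffun l => if l \in B then ((e l).2, (e l).1) else e l].

Definition swap_kernel (B : {set 'I_N}) (l : 'I_N) (e e' : bb) : C :=
  if l \in B then (e == (e'.2, e'.1))%:R else (e == e')%:R.

Lemma dform_swap B : dform (swap_kernel B) =
  \sum_(e : didx) conjc (doubled e) * doubled (swap_on B e).
Proof.
apply: eq_bigr => e _; rewrite (bigD1 (swap_on B e)) //= [X in _ + X]big1 ?addr0.
  rewrite big1 ?mul1r // => l _; rewrite /swap_kernel ffunE.
  by case: (l \in B); case: (e l) => a b /=; rewrite eqxx.
move=> e' ne; suff -> : \prod_l swap_kernel B l (e l) (e' l) = 0 by rewrite mul0r.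
have [l nl] : exists l, e' l != swap_on B e l.
  apply/existsP; rewrite -negb_forall; apply: contraNN ne => /forallP H.
  by apply/eqP/ffunP => l; exact/eqP.
rewrite (bigD1 l) //= [swap_kernel _ _ _ _](_ : _ = 0) ?mul0r //.
move: nl; rewrite /swap_kernel ffunE; case: (l \in B).
  case: (e l) => a b; case: (e' l) => c d /=; rewrite !xpair_eqE.
  by rewrite (eq_sym a) (eq_sym b) andbC => /negPf ->.
by rewrite eq_sym => /negPf ->.
Qed.

(** The identity is a product of [symk + altk], hence yields the sum of all weights. The partial
    swaps sum to the product of identity plus swap, which is [2 * symk] at each qubit and leaves
    [2 ^+ N] times the weight of [set0]. *)
Lemma sum_purity_deficit :
  \sum_(B : {set 'I_N}) (\sum_(e : didx) conjc (doubled e) * doubled e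
     - \sum_(e : didx) conjc (doubled e) * doubled (swap_on B e)) =
  (2 ^+ N * (\sum_(B : {set 'I_N} | B != set0) alt_weight B))%:C%C.
Proof.
rewrite sumrB sumr_const.
have -> : #|{: {set 'I_N}}| = (2 ^ N)%N.
  by rewrite -cardsT -powersetT card_powerset cardsT card_ord.
pose idk (l : 'I_N) (e e' : bb) : C := (e == e')%:R.
have -> : \sum_(e : didx) conjc (doubled e) * doubled e = dform idk.
  transitivity (dform (swap_kernel set0)).
    rewrite dform_swap; apply: eq_bigr => e _; congr (_ * doubled _).
    by apply/ffunP => l; rewrite ffunE inE.
  by apply: eq_dform => l e e'; rewrite /swap_kernel inE.
have -> : dform idk = (\sum_(B : {set 'I_N}) alt_weight B)%:C%C.
  rewrite (dform_expand (fun _ => 1) (fun _ => 1) symk altk) => [|l e e'].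
    rewrite rmorph_sum; apply: eq_bigr => B _ /=.
    by rewrite big1 ?mul1r ?alt_weightE // => l _; case: ifP.
  by rewrite /idk /symk /altk; field.
have -> : \sum_(B : {set 'I_N}) \sum_(e : didx) conjc (doubled e) * doubled (swap_on B e)
   = (2 ^+ N * alt_weight set0)%:C%C.
  under eq_bigr do rewrite -dform_swap.
  transitivity (dform (fun l e e' => (e == (e'.2, e'.1))%:R + idk l e e')).
    rewrite (dform_expand (fun _ => 1) (fun _ => 1) (fun e e' => (e == e')%:R)
      (fun e e' => (e == (e'.2, e'.1))%:R)) => [|l e e']; last by rewrite !mul1r.
    apply: eq_bigr => B _; rewrite big1 ?mul1r; last by move=> l _; case: ifP.
    by apply: eq_dform => l e e'; rewrite /swap_kernel; case: ifP.
  rewrite (dform_expand (fun _ => 2) (fun _ => 0) symk altk) => [|l e e']; last first.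
    by rewrite /idk /symk; field.
  rewrite (bigD1 set0) //= [X in _ + X]big1 ?addr0 => [|B B0]; last first.
    by have [l lB] := set0Pn _ B0; rewrite (bigD1 l) /= ?lB ?mul0r.
  rewrite alt_weightE rmorphM rmorphXn rmorph_nat; congr (_ * _).
  under eq_bigr do rewrite inE.
  by rewrite prodr_const card_ord.
rewrite (bigD1 set0) //= -[_ *+ (2 ^ N)%N]mulr_natl natrX -(rmorph_nat (real_complex R)) -rmorphXn -rmorphM -rmorphB /=.
by congr (_ %:C)%C; ring.
Qed.

End Doubled.

(** * Local measurements *)

Section PauliBases.
Variable R : realType.
Local Notation C := R[i].
Local Notation bb := (bool * bool)%type.

Definition half_phase : C := ((2^-1) +i* (2^-1))%C.

Definition pauli_phase (y c z : bool) : C :=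
  if z then (if y then 'i%C else 1) * (if c then -1 else 1) else 1.

(* [None], [Some false], [Some true] are the eigenbases of sigma_z, sigma_x,
   sigma_y; the phase (1 + i) / 2 replaces the factor 1 / sqrt 2. *)
Definition pauli (t : option bool) (c z : bool) : C :=
  if t is Some y then half_phase * pauli_phase y c z else (c == z)%:R.

Lemma half_phase_norm : half_phase * conjc half_phase = 2^-1.
Proof.
rewrite /half_phase /=; apply/eqP; rewrite eq_complex /=.
by apply/andP; split; apply/eqP; field.
Qed.

Lemma sum_option_bool (V : nmodType) (F : option bool -> V) :
  \sum_t F t = F None + (F (Some true) + F (Some false)).
Proof.
rewrite (bigD1 None) //= (bigD1 (Some true)) //= (bigD1 (Some false)) //=.
by rewrite big1 ?addr0 // => -[[]|].
Qed.

Lemma conjc_i : conjc ('i%C : C) = - 'i%C.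
Proof. by simpc. Qed.

Lemma i2 : ('i%C : C) * 'i%C = -1.
Proof. by rewrite -expr2 sqr_i. Qed.

Lemma mul_ii (x : C) : x * 'i%C * 'i%C = - x.
Proof. by rewrite -mulrA i2 mulrN1. Qed.

Lemma conjcM (x y : C) : conjc (x * y) = conjc x * conjc y.
Proof. exact: (rmorphM conjc). Qed.

Lemma conjcN (x : C) : conjc (- x) = - conjc x.
Proof. exact: (rmorphN conjc). Qed.

Lemma conjc_pauli_phase y c z : conjc (pauli_phase y c z) =
  if z then (if y then - 'i%C else 1) * (if c then -1 else 1) else 1.
Proof.
rewrite /pauli_phase; case: z; rewrite ?conjc1 // conjcM.
by congr (_ * _); [case: y | case: c]; rewrite ?conjc_i ?conjcN ?conjc1.
Qed.

Lemma conjc_prod (I : finType) (F : I -> C) :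
  conjc (\prod_l F l) = \prod_l conjc (F l).
Proof. exact: (rmorph_prod conjc). Qed.

Ltac simp_i := rewrite ?(mulr1, mul1r, mul0r, mulr0, mulrN1, mulrN, mulNr, opprK,
  mulrA, i2, mul_ii).

Lemma pauli_unitary t z z' :
  \sum_c pauli t c z * conjc (pauli t c z') = (z == z')%:R.
Proof.
rewrite big_bool; case: t => [y|]; last first.
  by rewrite /pauli !conjc_nat; case: z; case: z';
    rewrite /= ?mulr0 ?mulr1 ?addr0 ?add0r.
rewrite /pauli !conjcM mulrACA half_phase_norm mulrACA half_phase_norm.
rewrite !conjc_pauli_phase /pauli_phase.
by case: y; case: z; case: z'; simp_i; rewrite /=; field.
Qed.

(* The six eigenvectors form a complex projective 2-design. *)
Lemma pauli_design (e e' : bb) :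
  \sum_t \sum_c conjc (pauli t c e.1 * pauli t c e.2)
     * (pauli t c e'.1 * pauli t c e'.2) = 2 * symk R e e'.
Proof.
have E y c : conjc (pauli (Some y) c e.1 * pauli (Some y) c e.2)
     * (pauli (Some y) c e'.1 * pauli (Some y) c e'.2) =
   2^-1 * 2^-1 * (conjc (pauli_phase y c e.1) * conjc (pauli_phase y c e.2) *
     (pauli_phase y c e'.1 * pauli_phase y c e'.2)).
  by rewrite -half_phase_norm /pauli !conjcM; ring.
rewrite sum_option_bool !big_bool !E !conjc_pauli_phase /pauli_phase /symk /pauli.
rewrite conjcM !conjc_nat conjcM !conjc_nat.
by case: e {E} => [[] []]; case: e' => [[] []]; rewrite !xpair_eqE /=; simp_i;
  field.
Qed.

(** Read as a vector of the two copies, the antisymmetric matrix [sy] spans the singlet line and has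
    squared norm 2. *)
Lemma sy_altk (e e' : bb) :
  conjc (sy R e.1 e.2) * sy R e'.1 e'.2 = 2 * altk R e e'.
Proof.
have -> : conjc (sy R e.1 e.2) = - sy R e.1 e.2.
  by rewrite /sy; case: ifP => _; [|case: ifP => _];
    rewrite ?conjcN ?conjc_i ?conjc0 ?oppr0.
rewrite /altk /sy; case: e => [[] []]; case: e' => [[] []];
  rewrite ?xpair_eqE /=; simp_i; rewrite ?oppr0 ?mul0r; by field.
Qed.

End PauliBases.

(** * Measuring the qubits of [M] in fixed local bases *)

Section Measurement.
Variables (R : realType) (N : nat) (i j : 'I_N) (M : {set 'I_N}).
Local Notation normc := (@Normc.normc R).
Local Notation C := R[i].
Local Notation bb := (bool * bool)%type.

Definition local_basis (t : option bool) (l : 'I_N) (c z : bool) : C :=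
  if l \in M then pauli R t c z else (c == z)%:R.

Variable s : {ffun 'I_N -> option bool}.

(* The (i, j)-component of psi after the qubits of [M] have been measured in the
   bases [s] and the remaining ones in the computational basis, with joint
   outcome [w] (it vanishes unless w i = w j = 0). *)
Definition branch (psi : qidx N -> C) (w : qidx N) (x y : bool) : C :=
  \sum_(z : qidx N | ~~ z i && ~~ z j)
    (\prod_l local_basis (s l) l (w l) (z l)) * psi (qupd (qupd z i x) j y).

Definition branch4 psi w (k : 'I_4) : C := branch psi w (hi k) (lo k).

(** Entry of the symmetric matrix [T] attached to the decomposition into branches. *)
Definition flip_form (psi : qidx N -> C) (w w' : qidx N) : C :=
  \sum_k \sum_l branch4 psi w k * syy R k l * branch4 psi w' l.

Definition outcome (w : qidx N) : {set 'I_N} := [set l in M | w l].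

Definition strategy_value (psi : qidx N -> C) : R :=
  \sum_(c : {set 'I_N}) Num.sqrt (\sum_(w : qidx N | outcome w == c)
    \sum_(w' : qidx N | outcome w' == c) normc (flip_form psi w w') ^+ 2).

Lemma local_basis_unitary t l z z' :
  \sum_c local_basis t l c z * conjc (local_basis t l c z') = (z == z')%:R.
Proof.
rewrite /local_basis; case: (l \in M); first exact: pauli_unitary.
by rewrite big_bool !conjc_nat; case: z; case: z';
  rewrite /= ?mulr0 ?mulr1 ?addr0 ?add0r.
Qed.

(** Completeness of the product basis forces equal [z] in both factors, so the branches decompose
    the same reduced operator whatever the bases. *)
Lemma branch_complete psi x y x' y' :
  \sum_(w : qidx N) branch psi w x y * conjc (branch psi w x' y') =
  \sum_(z : qidx N | ~~ z i && ~~ z j) psi (qupd (qupd z i x) j y)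
    * conjc (psi (qupd (qupd z i x') j y')).
Proof.
under eq_bigr => w _.
  rewrite /branch rmorph_sum mulr_suml /=.
  under eq_bigr => z _ do rewrite mulr_sumr.
  over.
rewrite exchange_big; apply: eq_bigr => z zij /=.
rewrite exchange_big /=.
have key (z' : qidx N) : \sum_(w : qidx N)
    (\prod_l local_basis (s l) l (w l) (z l)) * psi (qupd (qupd z i x) j y) *
    conjc ((\prod_l local_basis (s l) l (w l) (z' l)) *
           psi (qupd (qupd z' i x') j y')) =
  (\prod_l (z l == z' l)%:R) *
    (psi (qupd (qupd z i x) j y) * conjc (psi (qupd (qupd z' i x') j y'))).
  under [X in _ = X * _]eq_bigr => l _ do rewrite -(local_basis_unitary (s l) l).
  rewrite bigA_distr_bigA mulr_suml; apply: eq_bigr => w _ /=.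
  by rewrite big_split [in LHS]conjcM conjc_prod /=; ring.
rewrite (bigD1 z) //= [X in _ + X]big1 ?addr0 => [|z' /andP[_ zz']].
  by rewrite key big1 ?mul1r // => l _; rewrite eqxx.
rewrite key; have [l nl] : exists l, z l != z' l.
  apply/existsP; rewrite -negb_forall; apply: contraNN zz' => /forallP H.
  by apply/eqP/ffunP => l; rewrite (eqP (H l)).
by rewrite (bigD1 l) //= (negPf nl) !mul0r.
Qed.

(** Branches scaled by [Num.sqrt (p a)] decompose the reduced operator. Blocks are labelled by
    ensemble member and outcome, so entries between different members do not enter and each block
    norm scales by [p a]. *)
Lemma Cij_le_strategy (n : nat) (p : 'I_n -> R) (psi : 'I_n -> qidx N -> C)
    (tau : qidx N -> qidx N -> C) : (forall k, 0 <= p k) ->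
  (forall q q', tau q q' = \sum_k (p k)%:C%C * (psi k q * conjc (psi k q'))) ->
  Cij tau i j <= \sum_k p k * strategy_value (psi k).
Proof.
move=> p0 tauE.
pose V (a : 'I_n * qidx N) (k : 'I_4) := (Num.sqrt (p a.1))%:C%C * branch4 (psi a.1) a.2 k.
pose lab (a : 'I_n * qidx N) := (a.1, outcome a.2).
apply: le_trans (wootters_bound _ _ _ lab V _ _) _.
  move=> k l; rewrite mxE /red2.
  transitivity (\sum_a0 \sum_(w : qidx N) V (a0, w) k * conjc (V (a0, w) l)); last first.
    by rewrite pair_big; apply: eq_bigr => -[].
  under eq_bigr do rewrite tauE.
  rewrite exchange_big; apply: eq_bigr => a _ /=.
  rewrite -mulr_sumr -branch_complete mulr_sumr; apply: eq_bigr => w _.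
  rewrite /V /branch4 /= conjcM conjc_real mulrACA -rmorphM /= -expr2.
  by rewrite sqr_sqrtr.
rewrite le_eqVlt; apply/orP; left; apply/eqP.
transitivity (\sum_a \sum_c Num.sqrt (\sum_(w : qidx N | outcome w == c)
    \sum_(w' : qidx N | outcome w' == c)
      normc ((p a)%:C%C * flip_form (psi a) w w') ^+ 2)).
  rewrite pair_big; apply: eq_bigr => -[a c] _ /=; congr Num.sqrt.
  have split1 (F : 'I_n * qidx N -> R) :
    \sum_(b | lab b == (a, c)) F b = \sum_(w : qidx N | outcome w == c) F (a, w).
    rewrite (reindex_onto (fun w => (a, w)) snd) /= => [|[b w] /=]; last first.
      by rewrite /lab xpair_eqE /= => /andP[/eqP ->].
    by apply: eq_bigl => w; rewrite /lab xpair_eqE /= !eqxx andbT.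
  rewrite split1; apply: eq_bigr => w _; rewrite split1; apply: eq_bigr => w' _.
  congr (normc _ ^+ 2); rewrite mulr_sumr; apply: eq_bigr => k _.
  rewrite mulr_sumr; apply: eq_bigr => l _; rewrite /V /=.
  by rewrite -[in RHS](sqr_sqrtr (p0 a)) expr2 rmorphM /=; ring.
apply: eq_bigr => a _; rewrite mulr_sumr; apply: eq_bigr => c _.
rewrite -[p a in RHS]ger0_norm // -sqrtr_sqr -sqrtrM ?sqr_ge0 //; congr Num.sqrt.
rewrite mulr_sumr; apply: eq_bigr => w _; rewrite mulr_sumr; apply: eq_bigr => w' _.
by rewrite Normc.normcM normc_realC // exprMn.
Qed.

(** Cauchy-Schwarz over the outcomes, which are subsets of [M]. *)
Lemma strategy_value_sqr psi : strategy_value psi ^+ 2 <=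
  2 ^+ #|M| * \sum_(w : qidx N) \sum_(w' : qidx N | outcome w' == outcome w)
     normc (flip_form psi w w') ^+ 2.
Proof.
pose F c := \sum_(w : qidx N | outcome w == c)
    \sum_(w' : qidx N | outcome w' == c) normc (flip_form psi w w') ^+ 2.
have F0 c : 0 <= F c.
  by apply: sumr_ge0 => w _; apply: sumr_ge0 => w' _; exact: sqr_ge0.
have -> : strategy_value psi = \sum_(c in powerset M) 1 * Num.sqrt (F c).
  rewrite /strategy_value (bigID (mem (powerset M))) /= [X in _ + X]big1 ?addr0.
    by apply: eq_bigr => c _; rewrite mul1r.
  move=> c; rewrite inE => cM; rewrite big_pred0 ?sqrtr0 // => w.
  apply/negP => /eqP wc; case/negP: cM; rewrite -wc.
  by apply/subsetP => l; rewrite inE => /andP[].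
apply: le_trans (sum_cauchy _ _ _ _ _) _.
under eq_bigr do rewrite expr1n.
rewrite sumr_const card_powerset natrX ler_wpM2l ?exprn_ge0 //.
under eq_bigr do rewrite sqr_sqrtr //.
have -> : \sum_(w : qidx N) \sum_(w' : qidx N | outcome w' == outcome w)
     normc (flip_form psi w w') ^+ 2 = \sum_c F c.
  rewrite (partition_big outcome predT) //=; apply: eq_bigr => c _.
  by apply: eq_bigr => w /eqP ->.
by rewrite [leRHS](bigID (mem (powerset M))) /= lerDl sumr_ge0.
Qed.

End Measurement.

(** * Averaging over random Pauli bases *)

Section StrategyAverage.
Variables (R : realType) (N : nat) (i j : 'I_N) (M : {set 'I_N}).
Local Notation normc := (@Normc.normc R).
Local Notation C := R[i].
Local Notation bb := (bool * bool)%type.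
Hypothesis ij : i != j.
Hypothesis iM : i \notin M.
Hypothesis jM : j \notin M.

Lemma sum_ord4 (V : nmodType) (F : bool -> bool -> V) :
  \sum_(k < 4) F (hi k) (lo k) = \sum_x \sum_y F x y.
Proof.
rewrite !big_ord_recl big_ord0 !big_bool /hi /lo /= addr0.
by rewrite addrA addrC [F true false + _]addrC [F false false + _]addrC.
Qed.

Lemma sum_split_pair (V : nmodType) (F : qidx N -> V) :
  \sum_(q : qidx N) F q = \sum_(z : qidx N | ~~ z i && ~~ z j)
    \sum_x \sum_y F (qupd (qupd z i x) j y).
Proof.
under [RHS]eq_bigr do rewrite pair_big.
rewrite pair_big /=.
rewrite [RHS](reindex_onto
  (fun q : qidx N => (qupd (qupd q i false) j false, (q i, q j)))
  (fun p => qupd (qupd p.1 i p.2.1) j p.2.2)) /=; last first.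
  move=> [z [x y]] /=; rewrite andbT => /andP[/negPf zi /negPf zj].
  congr (_, (_, _)); [apply/ffunP => l|..]; rewrite !ffunE ?eqxx ?(negPf ij) //.
  by case: eqP => [->//|_]; case: eqP => [->|].
apply: eq_big => [q|q _] /=.
  rewrite !ffunE !eqxx (negPf ij) /=; apply/esym/eqP/ffunP => l.
  by rewrite !ffunE; case: eqP => [->//|_]; case: eqP => [->|].
congr F; apply/ffunP => l.
by rewrite !ffunE; case: eqP => [->//|_]; case: eqP => [->|].
Qed.

(** Factor at qubit [l] of the flip form, as a functional of the doubled state; [c] packs the basis
    and the two results. The indicator at [i] and [j] reflects that branches vanish unless their
    results there are false. *)
Definition flip_factor (l : 'I_N) (c : option bool * bb) (e : bb) : C :=
  if (l == i) || (l == j) then (~~ c.2.1 && ~~ c.2.2)%:R * sy R e.1 e.2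
  else local_basis R N M c.1 l c.2.1 e.1 * local_basis R N M c.1 l c.2.2 e.2.

Lemma flip_formE s psi w w' : flip_form R N i j M s psi w w' =
  \sum_(e : didx N) (\prod_l flip_factor l (s l, (w l, w' l)) (e l))
    * doubled R N psi e.
Proof.
pose G (q q' : qidx N) :=
  (\prod_l flip_factor l (s l, (w l, w' l)) (q l, q' l)) * (psi q * psi q').
transitivity (\sum_(q : qidx N) \sum_(q' : qidx N) G q q'); last first.
  rewrite sum_didx; apply: eq_bigr => e _; rewrite /G; congr (_ * _).
  by apply: eq_bigr => l _; rewrite !ffunE; case: (e l).
rewrite sum_split_pair.
pose H x y x' y' := branch R N i j M s psi w x y * (sy R x x' * sy R y y')
   * branch R N i j M s psi w' x' y'.
transitivity (\sum_x \sum_y \sum_x' \sum_y' H x y x' y').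
  rewrite -sum_ord4; apply: eq_bigr => k _; rewrite -sum_ord4.
  by apply: eq_bigr => l _; rewrite /branch4 mxE.
rewrite [RHS]exchange_big; apply: eq_bigr => x _ /=.
rewrite [RHS]exchange_big; apply: eq_bigr => y _ /=.
under [RHS]eq_bigr do rewrite sum_split_pair exchange_big /=.
rewrite [RHS]exchange_big; apply: eq_bigr => x' _ /=.
under [RHS]eq_bigr do rewrite exchange_big /=.
rewrite [RHS]exchange_big; apply: eq_bigr => y' _ /=.
rewrite /H /branch !mulr_suml; apply: eq_bigr => z /andP[/negPf zi /negPf zj].
rewrite mulr_sumr; apply: eq_bigr => z' /andP[/negPf zi' /negPf zj'].
rewrite /G.
set A := \prod_l local_basis _ _ _ _ _ _ (z l).
set B := \prod_l local_basis _ _ _ _ _ _ (z' l).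
have -> : \prod_l flip_factor l (s l, (w l, w' l))
   (qupd (qupd z i x) j y l, qupd (qupd z' i x') j y' l) =
   A * B * (sy R x x' * sy R y y').
  have ji : j != i by rewrite eq_sym.
  rewrite /A /B -big_split /= (bigD1 i) //= (bigD1 j) //=.
  rewrite [\prod_l (local_basis _ _ _ _ _ _ _ * _)](bigD1 i) //=.
  rewrite [\prod_(l | l != i) (local_basis _ _ _ _ _ _ _ * _)](bigD1 j) //=.
  rewrite /flip_factor /local_basis (negPf iM) (negPf jM) !eqxx !orbT /=.
  rewrite zi zj zi' zj' !ffunE !eqxx (negPf ij) /=.
  rewrite -!natrM !mulnb !eqbF_neg.
  set p1 := \prod_(l | _) _; set p2 := \prod_(l | _) _.
  have -> : p1 = p2.
    apply: eq_bigr => l /andP[/negPf li /negPf lj].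
    by rewrite li lj /= !ffunE li lj.
  ring.
ring.
Qed.

Definition flip_kernel (l : 'I_N) (e e' : bb) : C :=
  \sum_(c : option bool * bb | (l \in M) ==> (c.2.1 == c.2.2))
    conjc (flip_factor l c e) * flip_factor l c e'.

(** Bases together with two outcomes amount to one choice [c] per qubit, and agreement on [M] is
    imposed qubit by qubit, so the sum is the form of a product kernel. *)
Lemma sum_strategies psi :
  (\sum_s \sum_(w : qidx N) \sum_(w' : qidx N | outcome N M w' == outcome N M w)
     normc (flip_form R N i j M s psi w w') ^+ 2)%:C%C =
  dform R N psi flip_kernel.
Proof.
rewrite (dform_gram _ _ psi _ (fun l c => (l \in M) ==> (c.2.1 == c.2.2))
   flip_factor) //; congr (_ %:C)%C.
pose cod (c : {ffun 'I_N -> option bool * bb}) :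
   {ffun 'I_N -> option bool} * (qidx N * qidx N) :=
  ([ffun l => (c l).1], ([ffun l => (c l).2.1], [ffun l => (c l).2.2])).
pose dec (p : {ffun 'I_N -> option bool} * (qidx N * qidx N)) :
  {ffun 'I_N -> option bool * bb} := [ffun l => (p.1 l, (p.2.1 l, p.2.2 l))].
under eq_bigr do rewrite pair_big_dep.
rewrite pair_big /= (reindex cod) /=; last first.
  exists dec => [c _|[s [w w']] _].
    by apply/ffunP => l; rewrite !ffunE; case: (c l) => t [].
  by rewrite /cod /dec; congr (_, (_, _)); apply/ffunP => l; rewrite !ffunE.
apply: eq_big => [c|c _].
  apply/eqP/forallP => [/setP E l|H].
    by have := E l; rewrite !inE !ffunE; case: (l \in M) => //= ->.
  apply/setP => l; rewrite !inE !ffunE.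
  by have := H l; case: (l \in M) => //= /eqP ->.
congr (normc _ ^+ 2); rewrite flip_formE; apply: eq_bigr => e _; congr (_ * _).
by apply: eq_bigr => l _; rewrite !ffunE; case: (c l) => t [].
Qed.

(** A measured qubit gives [2 * symk] by the 2-design property. At [i] and [j] each of the three
    bases gives [2 * altk]; elsewhere each gives the identity [altk + symk]. *)
Lemma flip_kernelE l e e' : flip_kernel l e e' =
  (if l \in M then 0 else if (l == i) || (l == j) then 6 else 3) * altk R e e' +
  (if l \in M then 2 else if (l == i) || (l == j) then 0 else 3) * symk R e e'.
Proof.
rewrite /flip_kernel.
pose H t (a b : bool) : C :=
  if (l \in M) ==> (a == b) then
    conjc (flip_factor l (t, (a, b)) e) * flip_factor l (t, (a, b)) e' else 0.
transitivity (\sum_t \sum_a \sum_b H t a b).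
  rewrite big_mkcond pair_big pair_big /=.
  rewrite (reindex (fun p : option bool * bool * bool => (p.1.1, (p.1.2, p.2)))) /=.
    by apply: eq_bigr => -[[t a] b].
  by exists (fun p => (p.1, p.2.1, p.2.2)) => [[[t a] b]|[t [a b]]].
rewrite /H /flip_factor; case: ifP => lM.
  have -> : (l == i) || (l == j) = false.
    apply/negbTE; rewrite negb_or.
    by apply/andP; split; apply: contraTneq lM => ->.
  rewrite mul0r add0r -pauli_design; apply: eq_bigr => t _; rewrite !big_bool /=.
  by rewrite /local_basis lM; rewrite !addr0 !add0r.
case: ifP => lij /=.
  rewrite sum_option_bool !big_bool /= !mul0r !mul1r conjc0 !mul0r !add0r.
  by rewrite sy_altk; ring.
rewrite sum_option_bool !big_bool /= /local_basis lM !conjcM !conjc_nat.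
by clear H; case: e => [[] []]; case: e' => [[] []]; rewrite /altk /symk !xpair_eqE /=; field.
Qed.

Lemma sum_strategy_value psi :
  \sum_s strategy_value R N i j M s psi ^+ 2 <=
  3 ^+ N * (4 * (4 / 3) ^+ #|M|) *
  \sum_(B : {set 'I_N} | [&& i \in B, j \in B & [disjoint M & B]])
     alt_weight R N psi B.
Proof.
apply: le_trans (ler_sum _ (fun s _ => strategy_value_sqr _ _ _ _ _ s psi)) _.
rewrite -mulr_sumr.
set S := \sum_s _.
pose y l : C := if l \in M then 0 else if (l == i) || (l == j) then 6 else 3.
pose x l : C := if l \in M then 2 else if (l == i) || (l == j) then 0 else 3.
pose k : R := 36 * 2 ^+ #|M| * 3 ^+ (N - 2 - #|M|).
pose P (B : {set 'I_N}) := [&& i \in B, j \in B & [disjoint M & B]].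
have sub : M \subset ~: [set i; j].
  apply/subsetP => l lM; rewrite !inE negb_or.
  by apply/andP; split; apply: contraTneq lM => ->.
have cC : #|~: [set i; j]| = (N - 2)%N.
  have := cardsC [set i; j]; rewrite cards2 ij card_ord /= => h.
  by rewrite -(addKn 2 #|~: _|) h.
have cM : (#|M| <= N - 2)%N by rewrite -cC subset_leq_card.
(* [x] vanishes at [i] and [j], and [y] on [M], so only [B] with [P B] survives: 6 from each of [i]
   and [j], 2 from each measured qubit, 3 from each other one. *)
have coef (B : {set 'I_N}) : \prod_l (if l \in B then y l else x l) = if P B then k%:C%C else 0.
  case: ifP => [/and3P[iB jB dB]|].
    rewrite (bigID (mem M)) /= (eq_bigr (fun _ => 2)) => [|l lM]; last first.
      by rewrite /x lM (disjointFr dB lM).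
    rewrite prodr_const (bigID (mem [set i; j])) /=.
    rewrite (eq_bigr (fun _ => 6)) => [|l /andP[/negPf lM]]; last first.
      by rewrite /y lM !inE => /orP[] /eqP ->; rewrite ?iB ?jB !eqxx ?orbT.
    rewrite (eq_bigl (mem [set i; j])) => [|l]; last first.
      rewrite !inE; case: eqP => [->|]; rewrite ?iM //=.
      by case: eqP => [->|]; rewrite ?jM ?andbF.
    rewrite prodr_const cards2 ij (eq_bigr (fun _ => 3)) => [|l /andP[/negPf lM]].
      rewrite prodr_const /k !rmorphM !rmorphXn !rmorph_nat.
      have -> : #|[pred l | (l \notin M) && (l \notin [set i; j])]| = (N - 2 - #|M|)%N.
        have -> : #|[pred l | (l \notin M) && (l \notin [set i; j])]| =
                  #|~: [set i; j] :\: M|.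
          by apply: eq_card => l; rewrite !inE.
        by rewrite cardsD (setIidPr sub) cC.
      by rewrite /=; ring.
    by rewrite /x /y lM !inE => /negPf ->; case: ifP.
  rewrite /P => /negbT; rewrite !negb_and => /or3P[iB|jB|].
  - by rewrite (bigD1 i) //= (negPf iB) /x (negPf iM) eqxx mul0r.
  - by rewrite (bigD1 j) //= (negPf jB) /x (negPf jM) eqxx orbT mul0r.
  - rewrite -setI_eq0 => /set0Pn [l]; rewrite inE => /andP[lM lB].
    by rewrite (bigD1 l) //= lB /y lM mul0r.
have SE : S = k * \sum_(B : {set 'I_N} | P B) alt_weight R N psi B.
  apply: (@complexI R); rewrite /= sum_strategies.
  rewrite (dform_expand _ _ psi x y (symk R) (altk R)); last exact: flip_kernelE.
  rewrite (eq_bigr (fun B => (if P B then k%:C%C else 0) *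
    (alt_weight R N psi B)%:C%C)); last first.
    by move=> B _; rewrite alt_weightE; congr (_ * _); exact: coef.
  rewrite [in RHS]rmorphM rmorph_sum [in RHS]big_mkcond mulr_sumr; apply: eq_bigr => B _ /=.
  by case: ifP => _; rewrite ?mul0r ?mulr0.
rewrite SE [X in X <= _]mulrA ler_wpM2r //.
  by apply: sumr_ge0 => B _; exact: alt_weight_ge0.
(* The Cauchy-Schwarz factor [2 ^+ #|M|] joins the one in [k]; taking out [3 ^+ N], the number of
   strategies, leaves [4 * (4 / 3) ^+ #|M|]. *)
rewrite le_eqVlt; apply/orP; left; apply/eqP.
have N2 : (2 <= N)%N by have := max_card [set i; j]; rewrite cards2 ij card_ord.
have -> : (3 : R) ^+ N = 3 ^+ 2 * 3 ^+ #|M| * 3 ^+ (N - 2 - #|M|).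
  by rewrite -!exprD; congr (_ ^+ _); lia.
rewrite /k exprMn exprVn.
have -> : (4 : R) ^+ #|M| = 2 ^+ #|M| * 2 ^+ #|M|.
  by rewrite -exprMn; congr (_ ^+ _); ring.
by field; rewrite expf_neq0 // pnatr_eq0.
Qed.

End StrategyAverage.

(** * The N-qubit inequality *)

Lemma card_pairs (N : nat) (B : {set 'I_N}) :
  (#|B| * #|B| =
   2 * (\sum_(i : 'I_N) \sum_(j : 'I_N | i < j) ((i \in B) && (j \in B))) + #|B|)%N.
Proof.
pose f (i j : 'I_N) : nat := (i \in B) && (j \in B).
have sB : (\sum_i (i \in B) = #|B|)%N by rewrite -sum1_card [RHS]big_mkcond.
have -> : (#|B| * #|B| = \sum_i \sum_j f i j)%N.
  rewrite -sB big_distrl; apply: eq_bigr => i _ /=.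
  by rewrite big_distrr; apply: eq_bigr => j _ /=; rewrite /f mulnb.
have split3 (i : 'I_N) : (\sum_j f i j =
  \sum_(j : 'I_N | i < j) f i j + \sum_(j : 'I_N | j < i) f i j + (i \in B))%N.
  rewrite (bigD1 i) //= addnC; congr addn; last by rewrite /f andbb.
  rewrite (bigID (fun j : 'I_N => (i < j)%N)) /=; congr addn; apply: eq_bigl => j.
    by case: ltngtP; rewrite ?andbF ?andbT //= => ij; apply/negP => /eqP e;
      rewrite e ltnn in ij.
  rewrite -leqNgt leq_eqVlt; case: (eqVneq j i) => [->|ji] /=; first by rewrite ltnn.
  by rewrite -val_eqE in ji; rewrite (negPf ji).
under eq_bigr do rewrite split3.
rewrite !big_split /= sB mul2n -addnn; congr (_ + _ + _)%N.
rewrite [LHS](exchange_big_dep predT) //=; apply: eq_bigr => i _.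
by apply: eq_bigr => j _; rewrite /f andbC.
Qed.

Section Core.
Variables (R : realType) (N : nat).
Local Notation C := R[i].

Definition strategy := (bool * {ffun 'I_N -> option bool})%type.

(* Either all qubits but i, j and one more are measured, or none. *)
Definition measured (i j : 'I_N) (b : bool) : {set 'I_N} :=
  if b then ~: [set i; j] :\ odflt i [pick l | l \notin [set i; j]] else set0.

(* For N = 5 neither of the two measurement patterns suffices on its own. *)
Definition pattern_weight (b : bool) : R :=
  if N == 5%N then (if b then 3 / 4 else 1 / 4) else (if b then 1 else 0).

Definition strategy_weight (x : strategy) : R := pattern_weight x.1 / 3 ^+ N.

Definition value (i j : 'I_N) (x : strategy) (psi : qidx N -> C) : R :=
  strategy_value R N i j (measured i j x.1) x.2 psi.

Lemma pattern_weight_ge0 b : 0 <= pattern_weight b.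
Proof. by rewrite /pattern_weight; case: ifP => _; case: b; lra. Qed.

Lemma strategy_weight_ge0 x : 0 <= strategy_weight x.
Proof. by rewrite divr_ge0 ?exprn_ge0 ?pattern_weight_ge0. Qed.

Lemma sum_strategy_weight : \sum_x strategy_weight x = 1.
Proof.
rewrite -(pair_bigA _ (fun b s => strategy_weight (b, s))) big_bool /=.
have c3 : #|{: {ffun 'I_N -> option bool}}| = (3 ^ N)%N.
  by rewrite card_ffun card_option card_bool card_ord.
rewrite /strategy_weight /= !sumr_const c3.
rewrite -[_ true / _ *+ _]mulr_natr -[_ false / _ *+ _]mulr_natr natrX.
rewrite !mulfVK ?expf_neq0 ?pnatr_eq0 // /pattern_weight.
by case: ifP => _; field.
Qed.

Lemma measured_notin i j b : (i \notin measured i j b) && (j \notin measured i j b).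
Proof. by case: b; rewrite /measured !inE ?eqxx ?orbT ?andbF. Qed.

Lemma measured_max (i j : 'I_N) (B : {set 'I_N}) : (3 <= N)%N -> i != j ->
  #|measured i j true| = (N - 3)%N /\
  ([disjoint measured i j true & B] -> (#|B| <= 3)%N).
Proof.
move=> N3 ij; rewrite /measured.
have cC : #|~: [set i; j]| = (N - 2)%N.
  have := cardsC [set i; j]; rewrite cards2 ij card_ord /= => h.
  by rewrite -(addKn 2 #|~: _|) h.
case: pickP => [l lij|none] /=; last first.
  have : (0 < #|~: [set i; j]|)%N by rewrite cC; lia.
  by case/card_gt0P => l; rewrite inE none.
split.
  have := cardsD1 l (~: [set i; j]); rewrite inE lij cC /= => h.
  by apply/eqP; rewrite -(eqn_add2l 1) -h; lia.
move=> dB.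
have : B \subset [set i; j; l].
  apply/subsetP => k kB; have := disjointFl dB kB; rewrite !inE.
  by case: (k == i); case: (k == j); case: (k == l).
move=> /subset_leq_card /leq_trans -> //.
by rewrite (leq_trans (leq_card_setU _ _)) // cards1 cards2; case: (_ != _).
Qed.

(** At 6 this reads 512/9 <= 64; each step multiplies the left side by at most 7/6 times 4/3, which
    is below 2. *)
Lemma pow_bound n : (6 <= n)%N -> n%:R * (4 * (4 / 3) ^+ (n - 3)) <= 2 ^+ n :> R.
Proof.
move=> n6; rewrite -(subnKC n6); elim: (n - 6)%N => [|m IH].
  by rewrite addn0 /=; lra.
have -> : (6 + m.+1 - 3 = (6 + m - 3).+1)%N by lia.
rewrite addnS [(4 / 3) ^+ _.+1]exprS [2 ^+ _.+1]exprS.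
have m0 : 0 <= m%:R :> R by [].
have a0 : 0 <= (4 / 3 : R) ^+ (6 + m - 3) by rewrite exprn_ge0 //; lra.
move: IH; rewrite -[(6 + m).+1]addn1 !natrD.
set a := (4 / 3) ^+ _ in a0 *; set b := 2 ^+ _.
have := mulr_ge0 m0 a0; lra.
Qed.

(** Under the maximal measurement [B] has at most three elements, and odd weights vanish, so only
    pairs remain, with loss [(4 / 3) ^+ (N - 3)]. With nothing measured every [B] containing [i] and
    [j] stays, without loss. *)
Lemma value_bound i j psi : (5 <= N)%N -> i != j ->
  \sum_x strategy_weight x * value i j x psi ^+ 2 <=
  \sum_(B : {set 'I_N} | B != set0) alt_weight R N psi B *
   (((i \in B) && (j \in B))%:R *
     (4 * (pattern_weight true * (4 / 3) ^+ (N - 3) * (#|B| == 2)%N%:R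
        + pattern_weight false))).
Proof.
move=> N5 ij.
pose E B := alt_weight R N psi B.
have E0 B : 0 <= E B by exact: alt_weight_ge0.
have p3 : (3 : R) ^+ N != 0 by rewrite expf_neq0 // pnatr_eq0.
have pat b : \sum_s strategy_weight (b, s) * value i j (b, s) psi ^+ 2 <=
   pattern_weight b * ((4 * (4 / 3) ^+ #|measured i j b|) *
  \sum_(B : {set 'I_N} | [&& i \in B, j \in B & [disjoint measured i j b & B]]) E B).
  rewrite /strategy_weight /= -mulr_sumr -mulrA ler_wpM2l ?pattern_weight_ge0 //.
  rewrite ler_pdivrMl ?exprn_gt0 // mulrA.
  by have /andP[iM jM] := measured_notin i j b; apply: sum_strategy_value.
rewrite -(pair_bigA _ (fun b s => strategy_weight (b, s) * value i j (b, s) psi ^+ 2)).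
rewrite big_bool /=; apply: le_trans (lerD (pat true) (pat false)) _.
rewrite (measured_max i j set0 _ ij).1; last by lia.
rewrite [measured i j false]/measured cards0 expr0 mulr1.
rewrite !mulr_sumr [X in X + _ <= _]big_mkcond [X in _ + X <= _]big_mkcond.
rewrite -big_split /= [leRHS]big_mkcond /=.
apply: ler_sum => B _.
have [->|B0] := eqVneq B set0; first by rewrite !inE /= addr0.
case: (boolP (i \in B)) => iB; case: (boolP (j \in B)) => jB /=;
  rewrite ?addr0 ?mul0r ?mulr0 // ?mul1r.
have -> : [disjoint set0 & B] by rewrite -setI_eq0 set0I.
have c2 : (2 <= #|B|)%N.
  have : [set i; j] \subset B by rewrite subUset !sub1set iB jB.
  by move/subset_leq_card; rewrite cards2 ij.
rewrite -/(E B).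
have [dB|_] := boolP [disjoint _ & B]; last first.
  set X := pattern_weight true * _ * _.
  have X0 : 0 <= X.
    by rewrite !mulr_ge0 ?pattern_weight_ge0 ?exprn_ge0 //; lra.
  by have := mulr_ge0 (E0 B) X0; lra.
have c3 : (#|B| <= 3)%N by apply: (measured_max i j B _ ij).2 dB; lia.
have [_|nB] := eqVneq #|B| 2%N.
  by rewrite le_eqVlt; apply/orP; left; apply/eqP; rewrite /= mulr1; ring.
have {}nB : #|B| = 3%N by lia.
by rewrite /E alt_weight_odd ?nB // !mulr0 addr0 mul0r.
Qed.

(** After exchanging sums, the coefficient of [alt_weight B] is [c B] times the number of pairs in
    [B]; it must not exceed [2 ^+ N] for even nonzero sizes. *)
Lemma qubit_bound psi : (5 <= N)%N ->
  N%:R * \sum_(i : 'I_N) \sum_(j : 'I_N | (i < j)%N)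
    \sum_x strategy_weight x * value i j x psi ^+ 2 <=
  2 ^+ N * \sum_(B : {set 'I_N} | B != set0) alt_weight R N psi B.
Proof.
move=> N5.
pose c (B : {set 'I_N}) : R := N%:R *
  (4 * (pattern_weight true * (4 / 3) ^+ (N - 3) * (#|B| == 2)%N%:R + pattern_weight false)).
apply: (@le_trans _ _ (\sum_(i : 'I_N) \sum_(j : 'I_N | (i < j)%N)
  \sum_(B : {set 'I_N} | B != set0) alt_weight R N psi B *
     (c B * ((i \in B) && (j \in B))%:R))).
  rewrite mulr_sumr; apply: ler_sum => i _; rewrite mulr_sumr.
  apply: ler_sum => j ij.
  have nij : i != j by apply: contraTneq ij => ->; rewrite ltnn.
  apply: le_trans (ler_wpM2l _ (value_bound i j psi N5 nij)) _ => //.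
  rewrite mulr_sumr; apply: ler_sum => B _.
  by rewrite le_eqVlt; apply/orP; left; apply/eqP; rewrite /c; ring.
under eq_bigr do rewrite exchange_big /=.
rewrite exchange_big /= mulr_sumr; apply: ler_sum => B B0.
under eq_bigr do rewrite -mulr_sumr -mulr_sumr -natr_sum.
rewrite -!mulr_sumr -natr_sum [leRHS]mulrC.
have [oB|eB] := boolP (odd #|B|); first by rewrite alt_weight_odd // !mul0r.
rewrite ler_wpM2l ?alt_weight_ge0 //.
set S := (\sum_i _)%N.
have cS : (#|B| * #|B| = 2 * S + #|B|)%N := card_pairs _ B.
have B2 : (2 <= #|B|)%N.
  by move: B0 eB; rewrite -card_gt0; case: #|B| => [|[|]].
have BN : (#|B| <= N)%N by rewrite (leq_trans (max_card _)) ?card_ord.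
(* For [N = 5], sizes 2 and 4 give 95/3 and 30, both below 32. The weight of the maximal measurement
   may range from 11/15 to 27/35, and 3/4 lies between. *)
rewrite /c /pattern_weight; case: eqVneq => [N5'|N5'].
  have [b2|b2] := eqVneq #|B| 2%N.
    have -> : S = 1%N by move: cS; rewrite b2; lia.
    by rewrite N5' /=; lra.
  have B5 : (#|B| <= 5)%N by rewrite (leq_trans BN) // N5'.
  have b4 : #|B| = 4%N by move: B5 eB B2 b2; case: #|B| => [|[|[|[|[|[|]]]]]].
  have -> : S = 6%N by move: cS; rewrite b4; lia.
  by rewrite N5' /=; lra.
have [b2|b2] := eqVneq #|B| 2%N; last by rewrite !(mulr0, addr0, mul0r) exprn_ge0.
have -> : S = 1%N by move: cS; rewrite b2; lia.
rewrite /= mul1r !mulr1 addr0; apply: pow_bound; lia.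
Qed.

End Core.

(** * Substates of a pure state *)

(** Expanding gives two diagonal and two cross sums; reindexing by [f] identifies the members of
    each couple. *)
Lemma sum_normc_involution (R : rcfType) (I : finType) (f : I -> I)
    (F : I -> R[i]) : involutive f ->
  (\sum_e Normc.normc (F e - F (f e)) ^+ 2)%:C%C =
  2 * (\sum_e conjc (F e) * F e - \sum_e conjc (F e) * F (f e)).
Proof.
move=> fK; rewrite rmorph_sum /=.
under eq_bigr => e _.
  rewrite normcMJ (_ : _ * _ = (conjc (F e) * F e + conjc (F (f e)) * F (f e))
     - (conjc (F e) * F (f e) + conjc (F (f e)) * F e)); last first.
    by rewrite (rmorphB conjc) /=; ring.
  over.
rewrite sumrB !big_split /=.
have -> : \sum_e conjc (F (f e)) * F (f e) = \sum_e conjc (F e) * F e.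
  by rewrite [RHS](reindex_inj (inv_inj fK)).
have -> : \sum_e conjc (F (f e)) * F e = \sum_e conjc (F e) * F (f e).
  by rewrite (reindex_inj (inv_inj fK)) /=; apply: eq_bigr => e _; rewrite fK.
ring.
Qed.

(** * Exchanging coordinates and counting boxes *)

Section Mix.
Variables (N : nat) (d : 'I_N -> nat).

Definition mix (A : {set 'I_N}) (u v : idx d) : idx d :=
  @finfun _ (fun i => 'I_(d i)) (fun i => if i \in A then v i else u i).

Lemma mixE A u v i : mix A u v i = if i \in A then v i else u i.
Proof. by rewrite ffunE. Qed.

Lemma glue_in (A : {set 'I_N}) (x : sidx d A) (z : sidx d (~: A)) i
  (h : i \in A) : glue x z i = x (exist _ i h).
Proof.
(* The proof given to the dependent match is generalised, then the scrutinee, to make the case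
   analysis well typed. *)
rewrite /glue ffunE; match goal with |- context [@erefl ?T ?x] => generalize (@erefl T x) end.
match goal with |- forall e : ?x = ?y, _ => generalize y at 2 3 end.
case=> e.
  by congr (x (exist _ _ _)); exact: bool_irrelevance.
by exfalso; rewrite h in e.
Qed.

Lemma glue_out (A : {set 'I_N}) (x : sidx d A) (z : sidx d (~: A)) i
  (h : i \in ~: A) : glue x z i = z (exist _ i h).
Proof.
rewrite /glue ffunE; match goal with |- context [@erefl ?T ?x] => generalize (@erefl T x) end.
match goal with |- forall e : ?x = ?y, _ => generalize y at 2 3 end.
case=> e.
  by exfalso; move: h; rewrite inE e.
by congr (z (exist _ _ _)); exact: bool_irrelevance.
Qed.

Lemma mix_glue (A : {set 'I_N}) (x y : sidx d A) (z t : sidx d (~: A)) :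
  mix A (glue x z) (glue y t) = glue y z.
Proof.
apply/ffunP => i; rewrite mixE; case: (boolP (i \in A)) => iA.
  by rewrite !(glue_in _ _ _ _ iA).
by rewrite -in_setC in iA; rewrite !(glue_out _ _ _ _ iA).
Qed.

Lemma sum_glue (V : nmodType) (A : {set 'I_N}) (F : idx d -> V) :
  \sum_(x : sidx d A) \sum_(z : sidx d (~: A)) F (glue x z) = \sum_(u : idx d) F u.
Proof.
rewrite pair_big /= [RHS](reindex (fun p : sidx d A * sidx d (~: A) => glue p.1 p.2)) //=.
exists (fun u : idx d => (@finfun _ (fun i : {i | i \in A} => 'I_(d (sval i))) (fun i => u (sval i)),
   @finfun _ (fun i : {i | i \in ~: A} => 'I_(d (sval i))) (fun i => u (sval i)))).
  move=> [x z] _ /=; congr (_, _); apply/ffunP => -[i h]; rewrite ffunE /=.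
    exact: glue_in.
  exact: glue_out.
move=> u _; apply/ffunP => i; case: (boolP (i \in A)) => iA /=.
  by rewrite (glue_in _ _ _ _ iA) ffunE.
by rewrite -in_setC in iA; rewrite (glue_out _ _ _ _ iA) ffunE.
Qed.

Lemma emb_mix (a b : idx d) (B : {set 'I_N}) (e : didx N) :
  emb a b (left_idx N (swap_on N B e)) =
    mix B (emb a b (left_idx N e)) (emb a b (right_idx N e)) /\
  emb a b (right_idx N (swap_on N B e)) =
    mix B (emb a b (right_idx N e)) (emb a b (left_idx N e)).
Proof.
by split; apply/ffunP => i; rewrite !ffunE; case: (i \in B).
Qed.

Lemma card_avoid (u : idx d) : (forall i, (2 <= d i)%N) ->
  #|[set o : idx d | [forall i, o i != u i]]| = (\prod_i (d i - 1))%N.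
Proof.
move=> d2.
have -> : #|[set o : idx d | [forall i, o i != u i]]| =
    #|(family (fun i => predC1 (u i)) : simpl_pred (idx d))|.
  by apply: eq_card => o; rewrite inE; apply/forallP/familyP.
rewrite card_family foldrE big_image; apply: eq_bigr => i _.
by rewrite cardC1 card_ord subn1.
Qed.

(** At a coordinate where [u] and [v] differ, the box is determined; where they agree, its second
    element has [d i - 1] choices. *)
Lemma sum_substates (R : realType) (G : idx d -> idx d -> R) :
  (forall i, (2 <= d i)%N) -> (forall u v, 0 <= G u v) ->
  \sum_(a : idx d) \sum_(b : idx d | [forall i, (a i < b i)%N])
     \sum_(e : didx N) G (emb a b (left_idx N e)) (emb a b (right_idx N e))
  <= \prod_i ((d i)%:R - 1) * \sum_(u : idx d) \sum_(v : idx d) G u v.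
Proof.
move=> d2 G0.
pose T := (idx d * idx d * (qidx N * qidx N))%type.
pose lt (x : T) := [forall i, (x.1.1 i < x.1.2 i)%N].
pose im (x : T) := (emb x.1.1 x.1.2 x.2.1, emb x.1.1 x.1.2 x.2.2).
have -> : \sum_(a : idx d) \sum_(b : idx d | [forall i, (a i < b i)%N])
     \sum_(e : didx N) G (emb a b (left_idx N e)) (emb a b (right_idx N e)) =
   \sum_(x : T | lt x) G (im x).1 (im x).2.
  rewrite pair_big_dep /=.
  under eq_bigr do rewrite -(sum_didx _ _ (fun q q' => G (emb _ _ q) (emb _ _ q'))) pair_big /=.
  by rewrite pair_big /=; apply: eq_bigl => -[[a b] [q q']] /=; rewrite andbT.
rewrite (partition_big im predT) //= pair_big mulr_sumr; apply: ler_sum => -[u v] _ /=.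
rewrite (eq_bigr (fun _ => G u v)) => [|x /andP[_ /eqP [-> ->]] //].
rewrite sumr_const -[leLHS]mulr_natl ler_wpM2r //.
have -> : \prod_i ((d i)%:R - 1) = (\prod_i (d i - 1))%N%:R :> R.
  by rewrite natr_prod; apply: eq_bigr => i _; rewrite natrB // (leq_trans _ (d2 i)).
rewrite ler_nat -(card_avoid u d2).
(* The corner of the box opposite to [u]. Together with [u] it determines the ordered box and [q],
   and then [v] determines [q']. *)
pose oth (x : T) : idx d := emb x.1.1 x.1.2 [ffun i => ~~ x.2.1 i].
set S := (X in (#|X| <= _)%N).
have inj : {in S &, injective oth}.
  move=> [[a b] [q q']] [[a' b'] [r r']].
  rewrite !unfold_in /= /lt /im /oth /= => /andP[/forallP ab /eqP[]] eu ev
    /andP[/forallP ab' /eqP[]] eu' ev' eo.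
  have E i : [/\ a i = a' i, b i = b' i, q i = r i & q' i = r' i].
    move: (ab i) (ab' i); move/ffunP/(_ i): eu; move/ffunP/(_ i): eu'.
    move/ffunP/(_ i): ev; move/ffunP/(_ i): ev'; move/ffunP/(_ i): eo.
    rewrite !ffunE => /(congr1 val) /= e1 /(congr1 val) /= e2.
    move=> /(congr1 val) /= e3 /(congr1 val) /= e4 /(congr1 val) /= e5.
    move: e1 e2 e3 e4 e5.
    by case: (q i); case: (r i); case: (q' i); case: (r' i) => /= *;
      split=> //; try apply: val_inj => /=; lia.
  by congr (_, _, (_, _)); apply/ffunP => i; have [] := E i.
rewrite -(card_in_imset inj); apply/subset_leq_card/subsetP => o /imsetP[x].
rewrite unfold_in => /andP[/forallP ab /eqP [eu _]] ->; rewrite inE.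
apply/forallP => i; rewrite -eu -val_eqE !ffunE /= neq_ltn.
by have := ab i; case: (x.2.1 i) => /= ->; rewrite ?orbT.
Qed.

End Mix.

(** * The pure-state concurrence as a sum of exchange defects *)

Section PureState.
Variables (R : realType) (N : nat) (d : 'I_N -> nat) (phi : idx d -> R[i]).
Local Notation normc := (@Normc.normc R).

(** Squared modulus of a 2 by 2 minor of [phi], read as a matrix across the cut between [A] and its
    complement. *)
Definition exchange_defect (A : {set 'I_N}) (u v : idx d) : R :=
  normc (phi u * phi v - phi (mix N d A u v) * phi (mix N d A v u)) ^+ 2.

Definition total_defect : R :=
  \sum_(A : {set 'I_N}) \sum_(u : idx d) \sum_(v : idx d) exchange_defect A u v.

Lemma total_defect_ge0 : 0 <= total_defect.
Proof. by do 3![apply: sumr_ge0 => ? _]; exact: sqr_ge0. Qed.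

(** The swap trick: purity is the expectation of the partial swap on [A] in the doubled state. *)
Lemma tr_sqE (A : {set 'I_N}) : tr_sq A (proj phi) =
  \sum_(u : idx d) \sum_(v : idx d) conjc (phi u * phi v) *
     (phi (mix N d A u v) * phi (mix N d A v u)).
Proof.
rewrite /tr_sq exchange_big -(sum_glue N d _ A); apply: eq_bigr => a _ /=.
under [RHS]eq_bigr do rewrite -(sum_glue N d _ A).
rewrite [RHS]exchange_big; apply: eq_bigr => b _ /=.
rewrite /ptrace mulr_suml; apply: eq_bigr => z _ /=.
rewrite mulr_sumr; apply: eq_bigr => t _ /=.
by rewrite !mix_glue /proj conjcM; ring.
Qed.

Lemma trace_sqr : trace (proj phi) ^+ 2 =
  \sum_(u : idx d) \sum_(v : idx d) conjc (phi u * phi v) * (phi u * phi v).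
Proof.
rewrite expr2 /trace mulr_suml; apply: eq_bigr => u _; rewrite mulr_sumr.
by apply: eq_bigr => v _; rewrite /proj conjcM; ring.
Qed.

Lemma mixK (A : {set 'I_N}) (u v : idx d) :
  mix N d A (mix N d A u v) (mix N d A v u) = u.
Proof. by apply/ffunP => i; rewrite !mixE; case: (i \in A). Qed.

Lemma purity_defect (A : {set 'I_N}) :
  2 * (trace (proj phi) ^+ 2 - tr_sq A (proj phi)) =
  (\sum_(u : idx d) \sum_(v : idx d) exchange_defect A u v)%:C%C.
Proof.
pose f (p : idx d * idx d) := (mix N d A p.1 p.2, mix N d A p.2 p.1).
have fK : involutive f by case=> u v; rewrite /f /= !mixK.
rewrite tr_sqE trace_sqr !pair_big /=.
by rewrite (sum_normc_involution _ _ f (fun p => phi p.1 * phi p.2) fK).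
Qed.

(** For [set0] and [setT] the purity is the squared trace, so the sum extends to all subsets with
    zero deficit there. *)
Lemma radicand (N0 : (0 < N)%N) :
  (2 ^+ N - 2) * trace (proj phi) ^+ 2 -
    \sum_(A : {set 'I_N} | (A != set0) && (A != setT)) tr_sq A (proj phi)
  = (total_defect / 2)%:C%C.
Proof.
have n0T : setT != set0 :> {set 'I_N}.
  by apply/set0Pn; exists (Ordinal N0); rewrite inE.
have t0 : tr_sq set0 (proj phi) = trace (proj phi) ^+ 2.
  rewrite tr_sqE trace_sqr; apply: eq_bigr => u _; apply: eq_bigr => v _.
  by congr (_ * (phi _ * phi _)); apply/ffunP => i; rewrite mixE inE.
have tT : tr_sq setT (proj phi) = trace (proj phi) ^+ 2.
  have mT u v : mix N d setT u v = v by apply/ffunP => i; rewrite mixE inE.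
  rewrite tr_sqE trace_sqr; apply: eq_bigr => u _; apply: eq_bigr => v _.
  by rewrite !mT; congr (_ * _); rewrite mulrC.
have E : \sum_(A : {set 'I_N}) tr_sq A (proj phi) = 2 * trace (proj phi) ^+ 2 +
   \sum_(A : {set 'I_N} | (A != set0) && (A != setT)) tr_sq A (proj phi).
  by rewrite (bigD1 set0) //= (bigD1 setT) //= t0 tT; ring.
have D : \sum_(A : {set 'I_N}) 2 * (trace (proj phi) ^+ 2 - tr_sq A (proj phi)) =
    total_defect%:C%C.
  by rewrite rmorph_sum; apply: eq_bigr => A _; exact: purity_defect.
have card2 : #|{: {set 'I_N}}| = (2 ^ N)%N.
  by rewrite -cardsT -powersetT card_powerset cardsT card_ord.
rewrite rmorphM fmorphV rmorph_nat /= -D -mulr_sumr sumrB sumr_const card2 E.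
rewrite -[_ *+ (2 ^ N)]mulr_natl natrX; by field.
Qed.

Lemma CN_pure_sqr : (0 < N)%N -> CN_pure phi ^+ 2 = 2 * total_defect / 2 ^+ N.
Proof.
move=> N0; rewrite /CN_pure /= radicand //= exprMn sqr_sqrtr; last first.
  by rewrite divr_ge0 ?total_defect_ge0.
rewrite exprMn exprVn exprAC sqr_sqrtr //; field.
by rewrite expf_neq0 // pnatr_eq0.
Qed.

Lemma CN_pure_ge0 : 0 <= CN_pure phi.
Proof. by rewrite mulr_ge0 ?divr_ge0 ?exprn_ge0 ?sqrtr_ge0. Qed.

End PureState.

Section PureBound.
Variables (R : realType) (N : nat) (d : 'I_N -> nat) (phi : idx d -> R[i]).

Definition restriction (a b : idx d) (q : qidx N) : R[i] := phi (emb a b q).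

Lemma alt_weight_restriction (a b : idx d) :
  2 ^+ N * \sum_(B : {set 'I_N} | B != set0) alt_weight R N (restriction a b) B =
  (\sum_(B : {set 'I_N}) \sum_(e : didx N) exchange_defect R N d phi B
     (emb a b (left_idx N e)) (emb a b (right_idx N e))) / 2.
Proof.
apply: (@complexI R); rewrite /= -sum_purity_deficit.
rewrite [in RHS]rmorphM fmorphV rmorph_nat rmorph_sum /= mulr_suml.
apply: eq_bigr => B _.
have swK : involutive (swap_on N B).
  by move=> e; apply/ffunP => l; rewrite !ffunE; case: (l \in B); case: (e l).
have := sum_normc_involution _ _ (swap_on N B) (doubled R N (restriction a b)) swK.
set X := _ - _ => H.
suff -> : \sum_(e : didx N) exchange_defect R N d phi B
     (emb a b (left_idx N e)) (emb a b (right_idx N e)) =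
   \sum_e Normc.normc (doubled R N (restriction a b) e -
      doubled R N (restriction a b) (swap_on N B e)) ^+ 2.
  by rewrite H; field.
apply: eq_bigr => e _; rewrite /exchange_defect /doubled /restriction.
by have [-> ->] := emb_mix N d a b B e.
Qed.

Lemma pure_bound : (5 <= N)%N -> (forall i, (2 <= d i)%N) ->
  N%:R / (2 ^+ (N - 2) * \prod_(i : 'I_N) ((d i)%:R - 1)) *
    \sum_(a : idx d) \sum_(b : idx d | [forall i, (a i < b i)%N])
       \sum_(i : 'I_N) \sum_(j : 'I_N | (i < j)%N)
          \sum_x strategy_weight R N x * value R N i j x (restriction a b) ^+ 2
  <= CN_pure phi ^+ 2.
Proof.
move=> N5 d2; have N0 : (0 < N)%N by lia.
set P := \prod_i _.
have P0 : 0 < P.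
  apply: prodr_gt0 => i _; rewrite subr_gt0 ltr1n; exact: d2.
have t0 n : 0 < (2 : R) ^+ n by rewrite exprn_gt0.
rewrite CN_pure_sqr //.
set S := \sum_(a : idx d) _.
(* The qubit inequality is applied in each box; the box count then bounds the summed defects by [P]
   times the total. *)
have key : N%:R * S <= P * (total_defect R N d phi / 2).
  rewrite mulr_sumr.
  apply: (@le_trans _ _ (\sum_(a : idx d) \sum_(b : idx d | [forall i, (a i < b i)%N])
    (\sum_(B : {set 'I_N}) \sum_(e : didx N) exchange_defect R N d phi B
     (emb a b (left_idx N e)) (emb a b (right_idx N e))) / 2)).
    apply: ler_sum => a _; rewrite mulr_sumr; apply: ler_sum => b _.
    by rewrite -alt_weight_restriction; exact: qubit_bound.
  under eq_bigr do rewrite -mulr_suml exchange_big /=.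
  rewrite -mulr_suml exchange_big /= mulrA ler_wpM2r ?invr_ge0 // /total_defect mulr_sumr.
  apply: ler_sum => B _; apply: sum_substates => // u v; exact: sqr_ge0.
have -> : (2 : R) ^+ N = 4 * 2 ^+ (N - 2).
  have -> : N = (2 + (N - 2))%N by lia.
  by rewrite exprD addKn; congr (_ * _); ring.
rewrite mulrAC ler_pdivrMr ?mulr_gt0 //.
apply: le_trans key _.
rewrite le_eqVlt; apply/orP; left; apply/eqP; field.
exact: lt0r_neq0.
Qed.

End PureBound.

(** * Mixed states *)

(** Triangle inequality for a weighted l2 norm: both squares are expanded and Cauchy-Schwarz is
    applied for each [k], [l]. *)
Lemma weighted_minkowski (R : rcfType) (X : finType) (Q : pred X) (n : nat)
    (p G : 'I_n -> R) (g : 'I_n -> X -> R) (w : X -> R) :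
  (forall k, 0 <= p k) -> (forall k, 0 <= G k) -> (forall x, 0 <= w x) ->
  (forall k, \sum_(x | Q x) w x * g k x ^+ 2 <= G k ^+ 2) ->
  \sum_(x | Q x) w x * (\sum_k p k * g k x) ^+ 2 <= (\sum_k p k * G k) ^+ 2.
Proof.
move=> p0 G0 w0 gG.
have -> : \sum_(x | Q x) w x * (\sum_k p k * g k x) ^+ 2 =
    \sum_k \sum_l p k * p l * \sum_(x | Q x) w x * (g k x * g l x).
  under eq_bigr do rewrite expr2 mulr_suml mulr_sumr.
  rewrite exchange_big; apply: eq_bigr => k _ /=.
  under eq_bigr do rewrite mulr_sumr mulr_sumr.
  rewrite exchange_big; apply: eq_bigr => l _ /=; rewrite mulr_sumr.
  by apply: eq_bigr => x _; ring.
rewrite expr2 mulr_suml; apply: ler_sum => k _; rewrite mulr_sumr.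
apply: ler_sum => l _; rewrite [leRHS]mulrACA ler_wpM2l ?mulr_ge0 //.
have -> : \sum_(x | Q x) w x * (g k x * g l x) =
    \sum_(x | Q x) (Num.sqrt (w x) * g k x) * (Num.sqrt (w x) * g l x).
  by apply: eq_bigr => x _; rewrite mulrACA -expr2 sqr_sqrtr.
apply: le_trans (sum_cauchy_sqrt _ _ _ _ _) _.
apply: ler_pM; rewrite ?sqrtr_ge0 // -[leRHS]ger0_norm // -sqrtr_sqr.
  by apply: ler_wsqrtr; under eq_bigr do rewrite exprMn sqr_sqrtr //; exact: gG.
by apply: ler_wsqrtr; under eq_bigr do rewrite exprMn sqr_sqrtr //; exact: gG.
Qed.

Section Ensembles.
Local Open Scope sesquilinear_scope.
Variables (R : realType) (N : nat) (d : 'I_N -> nat).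
Variable rho : idx d -> idx d -> R[i].

(** The spectral decomposition of [rho]; it ensures that the infimum in [CN] is over a nonempty
    set. *)
Lemma ensemble_exists : density rho ->
  exists (n : nat) (p : 'I_n -> R) (phi : 'I_n -> idx d -> R[i]), ensemble rho p phi.
Proof.
move=> [herm pos tr1].
pose T := [the finType of idx d].
pose n := #|T|.
pose A : 'M[R[i]]_n := \matrix_(a, b) rho (enum_val a) (enum_val b).
have Ah : A^t* = A by apply/matrixP => a b; rewrite !mxE conjcE -herm.
have An : A \is normalmx by apply/normalmxP; rewrite Ah.
pose P := spectralmx A.
have uP : P *m P^t* = 1%:M by apply/unitarymxP; exact: spectral_unitarymx.
have AP : A = P^t* *m diag_mx (spectral_diag A) *m P.
  by have := orthomx_spectralP An; rewrite invmx_unitary ?spectral_unitarymx.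
pose D a := spectral_diag A 0 a.
have D0 a : 0 <= D a.
  have -> : D a = (P *m A *m P^t*) a a.
    have -> : P *m A *m P^t* = diag_mx (spectral_diag A).
      by rewrite {1}AP !mulmxA uP mul1mx -mulmxA uP mulmx1.
    by rewrite mxE eqxx mulr1n.
  have := pos (fun u => conjc (P a (enum_rank u))); congr (0 <= _).
  rewrite exchange_big mxE (reindex (@enum_val T T)) /=; last first.
    exact: onW_bij (enum_val_bij _).
  apply: eq_bigr => y _; rewrite mxE mulr_suml.
  rewrite (reindex (@enum_val T T)) /=; last exact: onW_bij (enum_val_bij _).
  by apply: eq_bigr => x _; rewrite !mxE !enum_valK conjcK.
have DR a : (complex.Re (D a))%:C%C = D a by apply: RRe_real; exact: ger0_real.
exists n, (fun a => complex.Re (D a)), (fun a u => conjc (P a (enum_rank u))).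
have norm1 a : \sum_(u : idx d) conjc (P a (enum_rank u)) *
    conjc (conjc (P a (enum_rank u))) = 1.
  transitivity ((P *m P^t*) a a); last by rewrite uP mxE eqxx.
  rewrite mxE (reindex (@enum_val T T)) /=; last exact: onW_bij (enum_val_bij _).
  by apply: eq_bigr => x _; rewrite !mxE !enum_valK conjcK mulrC.
have dec u v : rho u v = \sum_a (complex.Re (D a))%:C%C *
    proj (fun u => conjc (P a (enum_rank u))) u v.
  have -> : rho u v = A (enum_rank u) (enum_rank v) by rewrite mxE !enum_rankK.
  rewrite {1}AP mxE; apply: eq_bigr => a _; rewrite mxE (bigD1 a) //= big1 ?addr0.
    by rewrite !mxE eqxx mulr1n DR /proj conjcK conjcE /D mulrAC mulrC mulrA.
  by move=> b /negPf ba; rewrite !mxE ba mulr0n mulr0.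
split=> //.
  by move=> a; rewrite -ler0c DR.
apply: (@complexI R); rewrite rmorph_sum /= rmorph1 -tr1 /trace.
under [RHS]eq_bigr do rewrite dec.
rewrite exchange_big; apply: eq_bigr => a _ /=.
by rewrite -mulr_sumr /proj norm1 mulr1.
Qed.

Lemma Cij_ge0 (tau : qidx N -> qidx N -> R[i]) i j : 0 <= Cij tau i j.
Proof. by rewrite /Cij /wootters le_max lexx. Qed.

Lemma sum_nest (V : nmodType) (L : rel (idx d)) (S : finType)
    (F : idx d -> idx d -> 'I_N -> 'I_N -> S -> V) :
  \sum_(a : idx d) \sum_(b : idx d | L a b)
    \sum_(i : 'I_N) \sum_(j : 'I_N | (i < j)%N) \sum_(x : S) F a b i j x =
  \sum_(y : idx d * idx d * 'I_N * 'I_N * S |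
      L y.1.1.1.1 y.1.1.1.2 && (y.1.1.2 < y.1.2)%N)
    F y.1.1.1.1 y.1.1.1.2 y.1.1.2 y.1.2 y.2.
Proof.
rewrite pair_big_dep pair_big_dep pair_big_dep pair_big_dep /=.
by apply: eq_bigl => y; rewrite !andbT.
Qed.

Lemma ensemble_bound (n : nat) (p : 'I_n -> R) (phi : 'I_n -> idx d -> R[i]) :
  (5 <= N)%N -> (forall i, (2 <= d i)%N) -> ensemble rho p phi ->
  N%:R / (2 ^+ (N - 2) * \prod_(i : 'I_N) ((d i)%:R - 1)) *
    \sum_(a : idx d) \sum_(b : idx d | [forall i, (a i < b i)%N])
       \sum_(i : 'I_N) \sum_(j : 'I_N | (i < j)%N)
          Cij (substate a b rho) i j ^+ 2 <= (\sum_k p k * CN_pure (phi k)) ^+ 2.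
Proof.
move=> N5 d2 [p0 _ _ rhoE].
set K := N%:R / _.
have K0 : 0 <= K.
  rewrite divr_ge0 // mulr_ge0 ?exprn_ge0 // prodr_ge0 // => i _.
  by rewrite subr_ge0 ler1n (leq_trans _ (d2 i)).
(* The strategy weights sum to 1, so every squared concurrence becomes an average over strategies,
   each term of which has its own bound by the ensemble. *)
have expand (C : idx d -> idx d -> 'I_N -> 'I_N -> R) :
   \sum_(a : idx d) \sum_(b : idx d | [forall i, (a i < b i)%N])
       \sum_(i : 'I_N) \sum_(j : 'I_N | (i < j)%N) C a b i j =
   \sum_(a : idx d) \sum_(b : idx d | [forall i, (a i < b i)%N])
       \sum_(i : 'I_N) \sum_(j : 'I_N | (i < j)%N)
          \sum_x strategy_weight R N x * C a b i j.
  do 4![apply: eq_bigr => ? _].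
  by rewrite -mulr_suml sum_strategy_weight // mul1r.
rewrite expand.
rewrite (sum_nest _ (fun a b : idx d => [forall i, (a i < b i)%N])) mulr_sumr.
set Q := BIG_P.
pose g k (y : idx d * idx d * 'I_N * 'I_N * strategy N) :=
  value R N y.1.1.2 y.1.2 y.2 (restriction R N d (phi k) y.1.1.1.1 y.1.1.1.2).
pose w (y : idx d * idx d * 'I_N * 'I_N * strategy N) := K * strategy_weight R N y.2.
have w0 y : 0 <= w y by rewrite mulr_ge0 ?strategy_weight_ge0.
apply: le_trans (weighted_minkowski _ _ Q n p (fun k => CN_pure (phi k)) g w p0 _ w0 _).
- apply: ler_sum => -[[[[a b] i] j] x] _.
  rewrite mulrA; apply: ler_wpM2l; first exact: (w0 (a, b, i, j, x)).
  have le : Cij (substate a b rho) i j <=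
      \sum_k p k * value R N i j x (restriction R N d (phi k) a b).
    by apply: Cij_le_strategy => // q q'; rewrite /substate rhoE.
  apply: lerXn2r; rewrite ?nnegrE ?Cij_ge0 //.
  exact: le_trans (Cij_ge0 _ _ _) le.
- by move=> k; exact: CN_pure_ge0.
- move=> k; apply: le_trans (pure_bound R N d (phi k) N5 d2).
  rewrite (sum_nest _ (fun a b : idx d => [forall i, (a i < b i)%N])) mulr_sumr.
  by rewrite le_eqVlt; apply/orP; left; apply/eqP/eq_bigr => y _; rewrite -[LHS]mulrA.
Qed.

End Ensembles.

Theorem theorem3 (R : realType) (N : nat) (d : 'I_N -> nat)
  (rho : idx d -> idx d -> R[i]) :
  (5 <= N)%N ->
  (forall i, (2 <= d i)%N) ->
  density rho ->
  CN rho ^+ 2 >=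
    N%:R / (2 ^+ (N - 2) * \prod_(i : 'I_N) ((d i)%:R - 1)) *
    \sum_(a : idx d) \sum_(b : idx d | [forall i, (a i < b i)%N])
       \sum_(i : 'I_N) \sum_(j : 'I_N | (i < j)%N)
          Cij (substate a b rho) i j ^+ 2.
Proof.
move=> N5 d2 rho_d; set B := _ * _.
have B0 : 0 <= B.
  rewrite mulr_ge0 ?divr_ge0 ?mulr_ge0 ?exprn_ge0 //.
    by apply: prodr_ge0 => i _; rewrite subr_ge0 ler1n (leq_trans _ (d2 i)).
  by do 4![apply: sumr_ge0 => ? _]; exact: sqr_ge0.
(* It remains that [Num.sqrt B] bounds all ensemble averages from below, and that the infimum is
   nonnegative so that squares can be compared. *)
rewrite -[leLHS]sqr_sqrtr // ler_sqr ?nnegrE ?sqrtr_ge0 //.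
  apply: lb_le_inf.
    have [n [p [phi ens]]] := ensemble_exists _ _ _ _ rho_d.
    by exists (\sum_k p k * CN_pure (phi k)); exists n, p, phi.
  move=> _ [n [p [phi [ens ->]]]].
  have c0 : 0 <= \sum_k p k * CN_pure (phi k).
    by case: ens => p0 _ _ _; apply: sumr_ge0 => k _; rewrite mulr_ge0 ?CN_pure_ge0.
  rewrite -[leRHS]ger0_norm // -sqrtr_sqr; apply: ler_wsqrtr.
  exact: ensemble_bound.
apply: lb_le_inf.
  have [n [p [phi ens]]] := ensemble_exists _ _ _ _ rho_d.
  by exists (\sum_k p k * CN_pure (phi k)); exists n, p, phi.
move=> _ [n [p [phi [[p0 _ _ _] ->]]]].
by apply: sumr_ge0 => k _; rewrite mulr_ge0 ?CN_pure_ge0.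
Qed.
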